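(* Let $\alpha=[1,a,a+1,\ldots,a+2t-3,b]\in P(X)$ be a Pfaffian of size $2t$. Then the minimal set of generators of the initial ideal $\operatorname{in}(I_\alpha(X))$ with respect to an anti-diagonal term order is given by: (i) all of the indeterminates in $A$; (ii) all of the $2$-adiags in $B\cup C$; (iii) all of the $t$-adiags in $B\cup D$ with at most one indeterminate in $B$; (iv) all of the $(t+1)$-adiags outside of $A$, with at most one indeterminate in $B$ and at most $t-1$ indeterminates in $B\cup D$.
   Context: Let $K$ be a field, $X=(X_{ij})$ a skew-symmetric $n\times n$ matrix of indeterminates, and $R=K[X]=K[X_{ij}: 1\le i<j\le n]$. For $1\le a_1<\dots<a_{2t}\le n$, $[a_1,\ldots,a_{2t}]$ denotes the Pfaffian of the skew-symmetric submatrix of $X$ with row and column indices $a_1,\ldots,a_{2t}$; it has size $2t$. $P(X)$ is the set of all Pfaffians of $X$, partially ordered by: $[a_1,\ldots,a_{2t}]\le[b_1,\ldots,b_{2s}]$ iff $t\ge s$ and $a_i\le b_i$ for $i=1,\ldots,2s$. The ideal cogenerated by $\alpha\in P(X)$ is $I_\alpha(X)=(\beta\in P(X): \beta\not\ge\alpha)\subset R$. A term order on $R$ is anti-diagonal if the initial monomial of every Pfaffian $[a_1,\ldots,a_{2t}]$ is $X_{a_1a_{2t}}X_{a_2a_{2t-1}}\cdots X_{a_ta_{t+1}}$; an arbitrary anti-diagonal term order is fixed. For $s\ge1$, an $s$-adiag is a monomial $X_{i_1j_1}\cdots X_{i_sj_s}$ with $i_1<i_2<\dots<i_s<j_s<j_{s-1}<\dots<j_1$.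 An $s$-adiag is said to be in a region if all its indeterminates are in that region, and outside of a region if none of its indeterminates is in that region. Here $t\ge 2$, $a\ge 2$ and $a+2t-3<b\le n$. Let $X_+=\{(i,j):1\le i<j\le n\}$; the indeterminate $X_{ij}$ ($i<j$) is identified with $(i,j)$. The regions of $X_+$ are $A=\{(i,j): j\le a-1\}$, $B=\{(i,j): i\le a-1,\ a\le j\le b-1\}$, $C=\{(i,j): i\le a-1,\ j\ge b\}$, $D=\{(i,j): i\ge a,\ j\le b-1\}$ (all with $1\le i<j\le n$).
   Formalization: As printed, the list generates but need not be minimal: for n=6, t=2, a=3, b=5, X_16X_25X_34 in (iv) is a multiple of X_16X_25 in (ii). Proved: (i)-(iv) generate, and the minimal generators are (i)-(iii) and those of (iv) with at most one indeterminate in B∪C. *)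

(* Defs.v *)
From mathcomp Require Import all_boot all_order all_algebra all_fingroup.
From mathcomp Require Export mpoly.

Set Implicit Arguments.
Unset Strict Implicit.
Unset Printing Implicit Defensive.

Import GRing.Theory.
Local Open Scope ring_scope.

(* The Pfaffian of a (2t) x (2t) skew-symmetric matrix, as the signed sum over
   the perfect matchings {s 0, s 1}, {s 2, s 3}, ... of its index set, each
   matching being represented by its unique permutation s with
   s (2k) < s (2k+1) and s 0 < s 2 < s 4 < ... *)

Lemma ord_even_subproof t (k : 'I_t) : (k.*2 < t.*2)%N.
Proof. by rewrite ltn_double. Qed.

Lemma ord_odd_subproof t (k : 'I_t) : (k.*2.+1 < t.*2)%N.
Proof. by rewrite ltn_Sdouble. Qed.

Definition ord_even t (k : 'I_t) : 'I_(t.*2) := Ordinal (ord_even_subproof k).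
Definition ord_odd t (k : 'I_t) : 'I_(t.*2) := Ordinal (ord_odd_subproof k).

Definition matching_perm t (s : 'S_(t.*2)) : bool :=
  [forall k : 'I_t, (s (ord_even k) < s (ord_odd k))%N] &&
  [forall k : 'I_t, forall l : 'I_t,
     (k < l)%N ==> (s (ord_even k) < s (ord_even l))%N].

Definition pfaffian (R : comNzRingType) t (A : 'M[R]_(t.*2)) : R :=
  \sum_(s : 'S_(t.*2) | matching_perm s)
     (-1) ^+ s * \prod_(k < t) A (s (ord_even k)) (s (ord_odd k)).

(* The indeterminates X_ij are indexed by the pairs i < j in 'I_n; the element
   i : 'I_n stands for the row or column number i.+1.  {mpoly K[_]} wants its
   indeterminates numbered, which enum_rank does. *)

Definition indet (n : nat) := {p : 'I_n * 'I_n | (p.1 < p.2)%N}.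

Definition row_no n (p : indet n) : nat := (val p).1.+1.
Definition col_no n (p : indet n) : nat := (val p).2.+1.

Notation mon n := 'X_{1.. #|{: indet n}|}.
Notation polyX K n := {mpoly K[#|{: indet n}|]}.

Definition mon_of n (p : indet n) : mon n := U_(enum_rank p)%MM.

(* The monomial X_ij; the value for j <= i is never used. *)
Definition Xmon n (i j : 'I_n) : mon n :=
  if insub (i, j) is Some p then mon_of p else 0%MM.

Definition skewX (K : fieldType) n : 'M[polyX K n]_n :=
  \matrix_(i, j) (if (i < j)%N then 'X_[Xmon i j]
                  else if (j < i)%N then - 'X_[Xmon j i] else 0).

(* The elements of P(X) of size 2t are given by their index sequences
   a_1 < ... < a_2t, where 0 < t. *)

Definition increasing n s (c : s.-tuple 'I_n) : bool :=
  sorted ltn (map val c).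

Definition in_PX n t (a : t.*2.-tuple 'I_n) : bool := (0 < t)%N && increasing a.

Definition Pf (K : fieldType) n t (a : t.*2.-tuple 'I_n) : polyX K n :=
  pfaffian (mxsub (tnth a) (tnth a) (skewX K n)).

Definition pf_le n t s (a : t.*2.-tuple 'I_n) (b : s.*2.-tuple 'I_n) : bool :=
  (s <= t)%N && all2 (fun i j : 'I_n => (i <= j)%N) (take s.*2 a) b.

Definition ideal_gen (R : comNzRingType) (S : R -> Prop) (f : R) : Prop :=
  exists (k : nat) (c g : 'I_k -> R),
    (forall i, S (g i)) /\ f = \sum_(i < k) c i * g i.

Definition cogenerated (K : fieldType) n t (alpha : t.*2.-tuple 'I_n) :
    polyX K n -> Prop :=
  ideal_gen (fun f => exists (s : nat) (b : s.*2.-tuple 'I_n),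
    [/\ in_PX b, ~~ pf_le alpha b & f = Pf K b]).

Definition term_order N (le : rel 'X_{1..N}) : Prop :=
  [/\ reflexive le, antisymmetric le, transitive le & total le] /\
  (forall m, le 0%MM m) /\
  (forall m m1 m2, le m1 m2 -> le (m1 + m)%MM (m2 + m)%MM).

Definition is_initial (K : fieldType) N (le : rel 'X_{1..N})
    (f : {mpoly K[N]}) (m : 'X_{1..N}) : Prop :=
  m \in msupp f /\ forall m', m' \in msupp f -> le m' m.

Definition initial_ideal (K : fieldType) N (le : rel 'X_{1..N})
    (I : {mpoly K[N]} -> Prop) : {mpoly K[N]} -> Prop :=
  ideal_gen (fun g => exists (f : {mpoly K[N]}) (m : 'X_{1..N}),
    [/\ I f, is_initial le f m & g = 'X_[m]]).

Lemma ord_lo_subproof s (k : 'I_s) : (k < s.*2)%N.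
Proof. by rewrite -addnn ltn_addr. Qed.

Definition ord_lo s (k : 'I_s) : 'I_(s.*2) := Ordinal (ord_lo_subproof k).

(* X_{c_1 c_2s} X_{c_2 c_(2s-1)} ... X_{c_s c_(s+1)} *)
Definition adiag_mon n s (c : s.*2.-tuple 'I_n) : mon n :=
  (\sum_(k < s) Xmon (tnth c (ord_lo k)) (tnth c (rev_ord (ord_lo k))))%MM.

Definition anti_diagonal (K : fieldType) n (le : rel (mon n)) : Prop :=
  forall t (a : t.*2.-tuple 'I_n), in_PX a -> is_initial le (Pf K a) (adiag_mon a).

(* c is the sequence i_1 < ... < i_s < j_s < ... < j_1. *)
Definition is_adiag n s (m : mon n) : Prop :=
  exists c : s.*2.-tuple 'I_n, [/\ (0 < s)%N, increasing c & m = adiag_mon c].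

Definition indets n (m : mon n) : {set indet n} :=
  [set p | (0 < m (enum_rank p))%N].

Definition regA n (a : nat) : {set indet n} :=
  [set p | (col_no p <= a - 1)%N].
Definition regB n (a b : nat) : {set indet n} :=
  [set p | (row_no p <= a - 1)%N && (a <= col_no p <= b - 1)%N].
Definition regC n (a b : nat) : {set indet n} :=
  [set p | (row_no p <= a - 1)%N && (b <= col_no p)%N].
Definition regD n (a b : nat) : {set indet n} :=
  [set p | (a <= row_no p)%N && (col_no p <= b - 1)%N].

Definition gens_i n a (m : mon n) : Prop :=
  exists2 p : indet n, p \in regA n a & m = mon_of p.

Definition gens_ii n a b (m : mon n) : Prop :=
  is_adiag 2 m /\ indets m \subset regB n a b :|: regC n a b.

Definition gens_iii n t a b (m : mon n) : Prop :=
  [/\ is_adiag t m, indets m \subset regB n a b :|: regD n a b &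
      (#|indets m :&: regB n a b| <= 1)%N].

Definition gens_iv n t a b (m : mon n) : Prop :=
  [/\ is_adiag t.+1 m, [disjoint indets m & regA n a],
      (#|indets m :&: regB n a b| <= 1)%N &
      (#|indets m :&: (regB n a b :|: regD n a b)| <= t - 1)%N].

Definition gens n t a b (m : mon n) : Prop :=
  [\/ gens_i a m, gens_ii a b m, gens_iii t a b m | gens_iv t a b m].

(* If b < n and 2 < a, some monomials of gens_iv have at least two
   indeterminates in C, hence are multiples of monomials of gens_ii
   (X_16 X_25 X_34 for t = 2, a = 3, b = 5, n = 6).  The irredundant ones are
   those with at most one indeterminate in the union of B and C. *)
Definition min_gens_iv n t a b (m : mon n) : Prop :=
  gens_iv t a b m /\ (#|indets m :&: (regB n a b :|: regC n a b)| <= 1)%N.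

Definition min_gens n t a b (m : mon n) : Prop :=
  [\/ gens_i a m, gens_ii a b m, gens_iii t a b m | min_gens_iv t a b m].

Definition generates (K : fieldType) N (G : 'X_{1..N} -> Prop)
    (J : {mpoly K[N]} -> Prop) : Prop :=
  forall f, J f <-> ideal_gen (fun g => exists2 m, G m & g = 'X_[m]) f.

Definition minimally_generates (K : fieldType) N (G : 'X_{1..N} -> Prop)
    (J : {mpoly K[N]} -> Prop) : Prop :=
  generates G J /\
  forall H : 'X_{1..N} -> Prop,
    (forall m, H m -> G m) -> generates H J -> forall m, G m -> H m.

(* Main.v *)
Require Import Defs.
From HB Require Import structures.
From mathcomp Require Import all_boot all_order all_algebra all_fingroup.
From mathcomp Require Import zify.

(* Write J for the ideal spanned by the listed monomials. They are initial
   monomials of Pfaffians not above alpha, so J lies in in(I_alpha). For the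
   converse, send X to Y^T J_0 Y, where J_0 is the standard symplectic form and Y
   is a generic 2t x n matrix whose row k vanishes to the left of column alpha_k.
   This kills I_alpha, and the leading monomial of the image of a Pfaffian
   [b_1, b_2, ...] above alpha is y_{1,b_1} y_{2,b_2} ... Row insertion (RSK) of
   the symmetric matrix of exponents turns a monomial outside J into a tableau
   whose columns have even length and are above alpha: an entry that is too small
   in its row, or a row too many, comes from a long antichain of the matrix, which
   the diagonal cuts into two anti-diagonals, one of them in J. The product of the
   Pfaffians of the columns has the degree of the monomial, and its image has
   a leading monomial that determines the tableau, hence the monomial. So in each
   degree the image has dimension at least the number of monomials outside J,
   which leaves no room for a further initial monomial. *)

(** Two unrelated monomial orders are in play. Of the given order on $K[X]$ only the term order
    axioms and the initial monomials of the Pfaffians are known; on $K[Y]$ the degree-lexicographic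
    order is used, in which diagonal terms lead. No link between them is needed, because only
    dimensions in a fixed degree are compared; in particular no straightening law enters. The field
    may have characteristic 2, where skew-symmetry does not imply alternation. Hence $J_0$ and the
    Pfaffians of its principal submatrices are computed over the integers and then mapped to $K$.
    Insertion is never performed on words. The row lengths of all partial tableaux are given by
    max-plus recurrences, so that column strictness, even columns, conservation of letters and
    invertibility become arithmetic with max and min. *)

Set Implicit Arguments.
Unset Strict Implicit.
Unset Printing Implicit Defensive.

Import GRing.Theory Order.TTheory.

(** * Last passage percolation and the Robinson-Schensted-Knuth correspondence *)

(* Heaviest weakly increasing lattice path in [0, x) x [0, y). *)
Fixpoint lpp (M : nat -> nat -> nat) (x : nat) : nat -> nat :=
  if x is x'.+1 then
    fix row (y : nat) : nat :=
      if y is y'.+1 then maxn (lpp M x' y) (row y') + M x' y' else 0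
  else fun=> 0.

(* The letters bumped by row insertion: the input of the next row. *)
Definition bump_mat (M : nat -> nat -> nat) (x y : nat) : nat :=
  minn (lpp M x y.+1) (lpp M x.+1 y) - lpp M x y.

(* [rsk_shape M k x y] is the length of the row number k of the tableau attached
   to the part of M in [0, x) x [0, y). *)
Definition rsk_shape (M : nat -> nat -> nat) (k : nat) : nat -> nat -> nat :=
  lpp (iter k bump_mat M).

Lemma lpp0y M y : lpp M 0 y = 0. Proof. by []. Qed.

Lemma lppx0 M x : lpp M x 0 = 0. Proof. by case: x. Qed.

Lemma lppSS M x y :
  lpp M x.+1 y.+1 = maxn (lpp M x y.+1) (lpp M x.+1 y) + M x y.
Proof. by []. Qed.

Lemma lpp_incx M x y : lpp M x y <= lpp M x.+1 y.
Proof. by case: y => [|y]; rewrite ?lppx0 // lppSS; lia. Qed.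

Lemma lpp_incy M x y : lpp M x y <= lpp M x y.+1.
Proof. by case: x => [|x] //; rewrite lppSS; lia. Qed.

Lemma lpp_mono M x1 x2 y1 y2 :
  x1 <= x2 -> y1 <= y2 -> lpp M x1 y1 <= lpp M x2 y2.
Proof.
move=> hx hy; apply: (@leq_trans (lpp M x2 y1)).
  by apply: (homo_leq (leqnn) leq_trans (fun x => lpp_incx M x y1)).
by apply: (homo_leq (leqnn) leq_trans (fun y => lpp_incy M x2 y)).
Qed.

Lemma lpp_transpose M x y : lpp (fun u v => M v u) x y = lpp M y x.
Proof.
have [d le_d] := ubnP (x + y); elim: d x y le_d => // d IHd.
case=> [|x] [|y] le_d; rewrite ?lppx0 // !lppSS.
by rewrite (IHd x y.+1) ?(IHd x.+1 y) 1?maxnC //; lia.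
Qed.

Lemma lpp_sym M : (forall x y, M x y = M y x) ->
  forall x y, lpp M x y = lpp M y x.
Proof.
move=> symM x y; have [d le_d] := ubnP (x + y); elim: d x y le_d => // d IHd.
case=> [|x] [|y] le_d; rewrite ?lppx0 // !lppSS symM.
by rewrite (IHd x y.+1) ?(IHd x.+1 y) 1?maxnC //; lia.
Qed.

Lemma bump_mat_sym M : (forall x y, M x y = M y x) ->
  forall x y, bump_mat M x y = bump_mat M y x.
Proof.
move=> symM x y; rewrite /bump_mat (lpp_sym symM x y).
by rewrite (lpp_sym symM x.+1) (lpp_sym symM x) minnC.
Qed.

Lemma iter_bump_sym M k : (forall x y, M x y = M y x) ->
  forall x y, iter k bump_mat M x y = iter k bump_mat M y x.
Proof. by move=> symM; elim: k => //= k; apply: bump_mat_sym. Qed.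

(** Both bounds go through one induction on [x + y]: [bump_mat M u v] is exactly what raises
    [lpp M u v] to the smaller of its two neighbours, so the bumped weight at [(u.+1, v.+1)] stays
    below that minimum ([E]). *)
Lemma lpp_bump_le M x y :
  (lpp (bump_mat M) x.+1 y <= lpp M x y) &&
  (lpp (bump_mat M) x y.+1 <= lpp M x y).
Proof.
have [d le_d] := ubnP (x + y); elim: d x y le_d => // d IHd x y le_d.
have E u v : u + v < d -> lpp (bump_mat M) u.+1 v.+1 <= minn (lpp M u v.+1) (lpp M u.+1 v).
  move=> ltd; rewrite lppSS [bump_mat M u v]/bump_mat.
  have := IHd u v ltd; have := lpp_incx M u v; have := lpp_incy M u v; lia.
case: x y le_d => [|x] [|y] le_d; rewrite ?lppx0 ?lpp0y //.
- by rewrite leqnn andbT (leq_trans (E 0 y _)) ?geq_minl.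
- by rewrite /= (leq_trans (E x 0 _)) ?geq_minr //; lia.
- have := E x y.+1; have := E x.+1 y; lia.
Qed.

Section RSKShape.
Variable M : nat -> nat -> nat.
Local Notation L := (rsk_shape M).

Lemma rsk_shape0y k y : L k 0 y = 0. Proof. by []. Qed.
Lemma rsk_shapex0 k x : L k x 0 = 0. Proof. exact: lppx0. Qed.

Lemma rsk_shape_mono k x1 x2 y1 y2 :
  x1 <= x2 -> y1 <= y2 -> L k x1 y1 <= L k x2 y2.
Proof. exact: lpp_mono. Qed.

Lemma rsk_shape_rec0 x y :
  L 0 x.+1 y.+1 = maxn (L 0 x y.+1) (L 0 x.+1 y) + M x y.
Proof. by []. Qed.

(** The local rule of growth diagrams in max-plus form. With [rsk_shape_rec0] it can be run across a
    unit square in both directions; the additive form avoids truncated subtraction. *)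
Lemma rsk_shape_recS k x y :
  L k.+1 x.+1 y.+1 + L k x y =
  maxn (L k.+1 x y.+1) (L k.+1 x.+1 y) + minn (L k x y.+1) (L k x.+1 y).
Proof.
rewrite /rsk_shape lppSS iterS; set N := iter k _ M; rewrite [bump_mat N x y]/bump_mat.
have := lpp_incx N x y; have := lpp_incy N x y; lia.
Qed.

(** Column strictness of the tableau whose row [k] has [L k x y] letters below [x]. *)
Lemma rsk_shape_strict k x y : L k.+1 x.+1 y <= L k x y.
Proof. by case/andP: (lpp_bump_le (iter k bump_mat M) x y). Qed.

Lemma rsk_shape_anti k l x y : k <= l -> L l x y <= L k x y.
Proof.
move=> /subnK<-; elim: (l - k) => // d IHd; rewrite addSn.
by apply: leq_trans IHd; apply: leq_trans (rsk_shape_strict _ _ _); apply: rsk_shape_mono.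
Qed.

(** Conservation of letters: by [step], the mixed second difference of the total length of the first
    [r] rows, plus the letters still to be inserted, is the entry of [M]. When nothing is left, this
    telescopes over the box. *)
Lemma rsk_shape_sum r x y : (forall u v, u < x -> v < y -> iter r bump_mat M u v = 0) ->
  \sum_(k < r) L k x y = \sum_(u < x) \sum_(v < y) M u v.
Proof.
have step u v : \sum_(k < r) L k u.+1 v.+1 + iter r bump_mat M u v + \sum_(k < r) L k u v
  = M u v + \sum_(k < r) L k u v.+1 + \sum_(k < r) L k u.+1 v.
  elim: r => [|r IHr]; first by rewrite !big_ord0 /= !addn0.
  have bumpE : iter r.+1 bump_mat M u v =
    minn (L r u v.+1) (L r u.+1 v) - L r u v by [].
  have recE : L r u.+1 v.+1 = maxn (L r u v.+1) (L r u.+1 v) + iter r bump_mat M u v.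
    by [].
  have incx : L r u v <= L r u.+1 v by apply: lpp_incx.
  have incy : L r u v <= L r u v.+1 by apply: lpp_incy.
  by move: (iter r.+1 _ _ _ _) bumpE IHr => _ -> /=; rewrite !big_ord_recr /=; lia.
elim: x y => [|x IHx] y vanish.
  by rewrite big_ord0 big1 // => k _; rewrite rsk_shape0y.
elim: y vanish => [|y IHy] vanish.
  by rewrite !big1 // => k _; rewrite ?big_ord0 ?rsk_shapex0.
have := step x y; rewrite vanish //.
rewrite IHy => [|u v ltu ltv]; last by apply: vanish => //; lia.
rewrite (IHx y.+1) => [|u v ltu ltv]; last by apply: vanish => //; lia.
rewrite (IHx y) => [|u v ltu ltv]; last by apply: vanish => //; lia.
have rec2 w : \sum_(u < x.+1) \sum_(v < w) M u v =
    \sum_(u < x) \sum_(v < w) M u v + \sum_(v < w) M x v by rewrite big_ord_recr.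
have rec1 : \sum_(v < y.+1) M x v = \sum_(v < y) M x v + M x y by rewrite big_ord_recr.
by move: rec1 (rec2 y) (rec2 y.+1) => /=; lia.
Qed.

Hypothesis symM : forall x y, M x y = M y x.

Lemma rsk_shape_sym k x y : L k x y = L k y x.
Proof. by apply: lpp_sym; apply: iter_bump_sym. Qed.

(* At a diagonal corner the two neighbours agree, so the local rule copies
   row 2i of the neighbour into rows 2i and 2i+1. *)
Lemma rsk_shape_even k x : (forall x, M x x = 0) -> L k.*2.+1 x x = L k.*2 x x.
Proof.
move=> M0; elim: x k => [|x IHx] k; first by rewrite !rsk_shape0y.
have sq i : L i x.+1 x = L i x x.+1 by rewrite rsk_shape_sym.
have top : L k.*2 x.+1 x.+1 = L k.*2 x x.+1.
  case: k => [|k]; first by rewrite double0 rsk_shape_rec0 sq M0; lia.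
  have := rsk_shape_recS k.*2.+1 x x; rewrite !sq -doubleS.
  have := IHx k; have := rsk_shape_strict k.*2 x x.
  have := @rsk_shape_mono k.*2.+1 x x x x.+1 (leqnn _) (leqnSn _).
  rewrite (sq k.*2.+1); lia.
have := rsk_shape_recS k.*2 x x; rewrite !sq top.
have := IHx k; have := rsk_shape_strict k.*2 x x.
have := @rsk_shape_mono k.*2.+1 x x x x.+1 (leqnn _) (leqnSn _).
rewrite (sq k.*2.+1); lia.
Qed.

End RSKShape.

(** The local rules are run backwards from the corner [(n, n)]: three corners of a square give the
    fourth. The side [y = n] is the hypothesis, and the side [x = n] follows by symmetry. *)
Lemma rsk_shape_inj n (M N : nat -> nat -> nat) :
  (forall x y, M x y = M y x) -> (forall x y, N x y = N y x) ->
  (forall k x, x <= n -> rsk_shape M k x n = rsk_shape N k x n) ->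
  forall x y, x < n -> y < n -> M x y = N x y.
Proof.
move=> symM symN eqn.
have eqall k x y : x <= n -> y <= n -> rsk_shape M k x y = rsk_shape N k x y.
  have [d le_d] := ubnP ((n - x) + (n - y)); elim: d k x y le_d => // d IHd.
  move=> k x y le_d lex ley.
  have [-> | nx] := eqVneq x n; first by rewrite (rsk_shape_sym symM) (rsk_shape_sym symN) eqn.
  have [-> | ny] := eqVneq y n; first by rewrite eqn.
  have := rsk_shape_recS M k x y; have := rsk_shape_recS N k x y.
  by rewrite !(IHd _ x y.+1) ?(IHd _ x.+1 y) ?(IHd _ x.+1 y.+1); lia.
move=> x y ltx lty; have := rsk_shape_rec0 M x y; have := rsk_shape_rec0 N x y.
by rewrite !eqall; lia.
Qed.

(** * Antichains *)

Definition down_chain (s : seq (nat * nat)) : bool :=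
  sorted (fun p q : nat * nat => (q.1 < p.1) && (p.2 < q.2)) s.

(** Going left along row [x], a zero entry cannot account for the excess over [c], which therefore
    persists until a nonzero entry is met. *)
Lemma lpp_last_step M c x y : lpp M x y <= c < lpp M x.+1 y ->
  exists z, [/\ z < y, 0 < M x z & c < lpp M x.+1 z.+1].
Proof.
elim: y => [|y IHy]; first by rewrite !lppx0 andbC.
have [M0 | Mpos] := posnP (M x y); last by case/andP=> _ ltc; exists y.
have := lpp_incy M x y; rewrite lppSS M0 => le1 lt1.
by have [|z [ltz Mz ltL]] := IHy; [lia | exists z; split=> //; lia].
Qed.

Lemma bump_mat_left M x y : 0 < bump_mat M x y ->
  exists z, [/\ z < y, 0 < M x z & lpp M x y < lpp M x.+1 z.+1].
Proof. by rewrite /bump_mat => pos; apply: lpp_last_step; lia. Qed.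

Lemma bump_mat_below M x y : 0 < bump_mat M x y ->
  exists z, [/\ z < x, 0 < M z y & lpp M x y < lpp M z.+1 y.+1].
Proof.
rewrite /bump_mat => pos.
have [|z] := @lpp_last_step (fun u v => M v u) (lpp M x y) y x.
  by rewrite !(lpp_transpose M); lia.
by rewrite (lpp_transpose M); exists z.
Qed.

(* Consecutive points p, q of a chain of bumped letters come from letters in
   the row of p and in the column of q; a comparison of path weights shows
   that one of these letters lies in the box between p and q. *)
Lemma bump_between M (p q : nat * nat) :
  0 < bump_mat M p.1 p.2 -> 0 < bump_mat M q.1 q.2 -> q.1 < p.1 -> p.2 < q.2 ->
  exists r : nat * nat, [/\ 0 < M r.1 r.2, q.1 <= r.1 < p.1 & p.2 <= r.2 < q.2].
Proof.
case: p q => [x1 y1] [x2 y2] /= pos1 pos2 ltx lty.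
have [z1 [lt1 M1 L1]] := bump_mat_below pos1.
have [z2 [lt2 M2 L2]] := bump_mat_left pos2.
have [le1 | gt1] := leqP x2 z1; first by exists (z1, y1); split=> //=; lia.
have [le2 | gt2] := leqP y1 z2; first by exists (x2, z2); split=> //=; lia.
(* Otherwise the weights G would satisfy G(x1,y1) < G(z1+1,y1+1) <= G(x2,y2) < G(x2+1,z2+1) <=
   G(x1,y1). *)
have := @lpp_mono M z1.+1 x2 y1.+1 y2 gt1 lty.
have := @lpp_mono M x2.+1 x1 z2.+1 y1 ltx gt2.
lia.
Qed.

(** Each gap between consecutive points receives a letter by [bump_between], and the last point is
    replaced by a letter of its column. The final conjunct is the invariant that keeps the next
    letter, found one box earlier, strictly chained to [q]. *)
Lemma bump_chain_tail M p s :
  down_chain (p :: s) -> all (fun q => 0 < bump_mat M q.1 q.2) (p :: s) ->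
  exists q s', [/\ down_chain (q :: s'), all (fun r => 0 < M r.1 r.2) (q :: s'),
    size s' = size s & (q.1 < p.1) && (p.2 <= q.2)].
Proof.
elim: s p => [|p2 s IHs] p /=.
  move=> _ /andP[pos _].
  have [z [ltz Mz _]] := bump_mat_below pos.
  by exists (z, p.2), [::]; split=> //=; rewrite ?Mz ?ltz ?leqnn.
move=> /andP[/andP[lt1 lt2] ch] /andP[pos1 pos].
have [q [s' [ch' pos' sz lq]]] := IHs _ ch pos.
have pos2 : 0 < bump_mat M p2.1 p2.2 by case/andP: pos.
have [r [Mr r1 r2]] := bump_between pos1 pos2 lt1 lt2.
exists r, (q :: s'); split=> //=; last 2 first.
- by rewrite sz.
- lia.
- apply/andP; split; [lia | exact: ch'].
- by rewrite Mr.
Qed.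

(** The extra point is a letter to the left of [p] in its row. Preserving the first coordinate of
    the head is what later turns a bound on a tableau entry into a bound on a whole antichain. *)
Lemma bump_chain M p s :
  down_chain (p :: s) -> all (fun q => 0 < bump_mat M q.1 q.2) (p :: s) ->
  exists q s', [/\ down_chain (q :: s'), all (fun r => 0 < M r.1 r.2) (q :: s'),
    size s' = (size s).+1 & q.1 = p.1].
Proof.
move=> ch pos; have [q [s' [ch' pos' sz lq]]] := bump_chain_tail ch pos.
have [|z [ltz Mz _]] := @bump_mat_left M p.1 p.2; first by case/andP: pos.
exists (p.1, z), (q :: s'); split=> //=; last by rewrite sz.
  by apply/andP; split; [lia | exact: ch'].
by rewrite Mz.
Qed.

Lemma iter_bump_chain M r x y : 0 < iter r bump_mat M x y ->
  exists p s, [/\ down_chain (p :: s), all (fun q => 0 < M q.1 q.2) (p :: s),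
    size s = r & p.1 = x].
Proof.
have main k : k <= r -> 0 < iter r bump_mat M x y ->
  exists p s, [/\ down_chain (p :: s),
    all (fun q => 0 < iter (r - k) bump_mat M q.1 q.2) (p :: s),
    size s = k & p.1 = x].
  elim: k => [|k IHk] ltk pos.
    by exists (x, y), [::]; split=> //=; rewrite subn0 pos.
  have [p [s [ch pos' sz px]]] := IHk (ltnW ltk) pos.
  have E : r - k = (r - k.+1).+1 by lia.
  rewrite E in pos'.
  have [q [s' [? ? sz' qp]]] := bump_chain ch pos'.
  by exists q, s'; split=> //; rewrite ?sz' ?sz ?qp.
by move=> pos; have := main r (leqnn r) pos; rewrite subnn.
Qed.

Lemma lpp_gt0 M x y : 0 < lpp M x y -> exists u v, [/\ u < x, v < y & 0 < M u v].
Proof.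
elim: x y => // x IHx; elim => // y IHy; rewrite lppSS => pos.
have [lt0 | le0] := ltnP 0 (lpp M x y.+1).
  by have [u [v [? ? ?]]] := IHx _ lt0; exists u, v; split=> //; lia.
have [lt1 | le1] := ltnP 0 (lpp M x.+1 y).
  by have [u [v [? ? ?]]] := IHy lt1; exists u, v; split=> //; lia.
by exists x, y; split=> //; lia.
Qed.

Lemma rsk_shape_chain M r x y : 0 < rsk_shape M r x y ->
  exists p s, [/\ down_chain (p :: s), all (fun q => 0 < M q.1 q.2) (p :: s),
    size s = r & p.1 < x].
Proof.
case/lpp_gt0=> u [v [ltu _]] /iter_bump_chain[p [s [? ? ? pu]]].
by exists p, s; rewrite pu.
Qed.

Local Open Scope ring_scope.

(** * Pfaffians *)

Section Pairing.
Variable p : nat.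

Lemma half_ord_subproof (i : 'I_(p.*2)) : (i./2 < p)%N.
Proof. by rewrite ltn_half_double. Qed.

Definition half_ord (i : 'I_(p.*2)) : 'I_p := Ordinal (half_ord_subproof i).

Lemma half_even k : half_ord (ord_even k) = k.
Proof. by apply: val_inj; rewrite /= doubleK. Qed.

Lemma half_odd k : half_ord (ord_odd k) = k.
Proof. by apply: val_inj; rewrite /= uphalf_double. Qed.

Lemma ord_evenE (i : 'I_(p.*2)) : ~~ odd i -> ord_even (half_ord i) = i.
Proof. by move=> ev; apply: val_inj; rewrite /= even_halfK. Qed.

Lemma ord_oddE (i : 'I_(p.*2)) : odd i -> ord_odd (half_ord i) = i.
Proof. by move=> od; apply: val_inj; rewrite /= odd_halfK //; case: (val i) od. Qed.

Lemma eq_even (k l : 'I_p) : (ord_even k == ord_even l) = (k == l).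
Proof. by rewrite -!val_eqE /= -!muln2 eqn_pmul2r. Qed.

Lemma eq_odd (k l : 'I_p) : (ord_odd k == ord_odd l) = (k == l).
Proof. by rewrite -!val_eqE /= eqSS -!muln2 eqn_pmul2r. Qed.

Lemma eq_even_odd (k l : 'I_p) : (ord_even k == ord_odd l) = false.
Proof. by rewrite -val_eqE /=; apply/eqP => /(congr1 odd); rewrite /= !odd_double. Qed.

Lemma eq_odd_even (k l : 'I_p) : (ord_odd k == ord_even l) = false.
Proof. by rewrite eq_sym eq_even_odd. Qed.

Definition eq_pair := (eq_even, eq_odd, eq_even_odd, eq_odd_even).

Variant ord_pair_spec (i : 'I_(p.*2)) : 'I_(p.*2) -> Type :=
  | OrdEven k : ord_pair_spec i (ord_even k)
  | OrdOdd k : ord_pair_spec i (ord_odd k).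

Lemma ord_pairP i : ord_pair_spec i i.
Proof.
have [od | ev] := boolP (odd i).
  by rewrite -{2}(ord_oddE od); constructor.
by rewrite -{2}(ord_evenE ev); constructor.
Qed.

Lemma big_pairing (R : comNzRingType) (F : 'I_(p.*2) -> R) :
  \prod_i F i = \prod_(k < p) (F (ord_even k) * F (ord_odd k)).
Proof.
rewrite (partition_big half_ord predT) //=; apply: eq_bigr => k _.
rewrite (bigD1 (ord_even k)) ?half_even //=; congr (_ * _).
rewrite (bigD1 (ord_odd k)) ?half_odd ?eq_pair ?eqxx //= big1 ?mulr1 // => i.
by case: (ord_pairP i) => l; rewrite ?half_even ?half_odd !eq_pair;
  case: (l == k).
Qed.

Definition partner_fun (i : 'I_(p.*2)) : 'I_(p.*2) :=
  if odd i then ord_even (half_ord i) else ord_odd (half_ord i).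

Lemma partner_even k : partner_fun (ord_even k) = ord_odd k.
Proof. by rewrite /partner_fun /= odd_double half_even. Qed.

Lemma partner_odd k : partner_fun (ord_odd k) = ord_even k.
Proof. by rewrite /partner_fun /= odd_double half_odd. Qed.

Lemma partner_funK : involutive partner_fun.
Proof. by move=> i; case: (ord_pairP i) => k; rewrite ?(partner_even, partner_odd). Qed.

(** The matching {s 0, s 1}, {s 2, s 3}, ... is encoded as the fixed-point-free involution
    [partner ^ s]. Exchanging the members of a pair, or two pairs, commutes with [partner] and so
    leaves the matching unchanged. *)
Definition partner : 'S_(p.*2) := perm (can_inj partner_funK).

Lemma partnerE i : partner i = partner_fun i. Proof. exact: permE. Qed.

Definition swap_pair (k : 'I_p) : 'S_(p.*2) := tperm (ord_even k) (ord_odd k).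

Definition swap_pairs (k l : 'I_p) : 'S_(p.*2) :=
  (tperm (ord_even k) (ord_even l) * tperm (ord_odd k) (ord_odd l))%g.

Lemma swap_pair_even k l :
  swap_pair k (ord_even l) = if l == k then ord_odd k else ord_even l.
Proof.
rewrite /swap_pair permE /= eq_even eq_pair.
by case: eqP => // ->.
Qed.

Lemma swap_pair_odd k l :
  swap_pair k (ord_odd l) = if l == k then ord_even k else ord_odd l.
Proof. by rewrite /swap_pair permE /= !eq_pair; case: eqP => // ->. Qed.

Lemma swap_pairs_even k l m : swap_pairs k l (ord_even m) = ord_even (tperm k l m).
Proof.
rewrite /swap_pairs permM (permE _ (ord_even m)) /= !eq_even [tperm k l m]permE /=.
by case: eqP => _; [|case: eqP => _]; rewrite permE /= !eq_pair.
Qed.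

Lemma swap_pairs_odd k l m : swap_pairs k l (ord_odd m) = ord_odd (tperm k l m).
Proof.
rewrite /swap_pairs permM (permE _ (ord_odd m)) /= !eq_pair !permE /= !eq_pair.
by case: eqP => _; [|case: eqP => _].
Qed.

Lemma odd_swap_pairs k l s : odd_perm (swap_pairs k l * s) = odd_perm s.
Proof. by rewrite /swap_pairs -mulgA !odd_mul_tperm !eq_pair addbA addbb. Qed.

Lemma partner_swap_pair k : (partner ^ swap_pair k = partner)%g.
Proof.
apply/conjg_fixP/commgP/permP => i; rewrite !permM !partnerE.
by case: (ord_pairP i) => l;
  rewrite ?partner_even ?partner_odd ?swap_pair_even ?swap_pair_odd;
  case: (l == k); rewrite ?partner_even ?partner_odd.
Qed.

Lemma partner_swap_pairs k l : (partner ^ swap_pairs k l = partner)%g.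
Proof.
apply/conjg_fixP/commgP/permP => i; rewrite [LHS]permM [RHS]permM !partnerE.
by case: (ord_pairP i) => m; rewrite ?partner_even ?partner_odd
   ?swap_pairs_even ?swap_pairs_odd ?partner_even ?partner_odd.
Qed.

End Pairing.

Section PfaffianTerms.
Variables (p : nat) (R : comNzRingType) (A : 'M[R]_(p.*2)).
Hypothesis skewA : forall i j, A i j = - A j i.

Definition pf_term (s : 'S_(p.*2)) : R :=
  (-1) ^+ s * \prod_(k < p) A (s (ord_even k)) (s (ord_odd k)).

Lemma pf_term_swap_pair k s : pf_term (swap_pair k * s) = pf_term s.
Proof.
rewrite /pf_term odd_mul_tperm eq_even_odd /= signrN.
rewrite (bigD1 k) //= [in RHS](bigD1 k) //=.
rewrite ![(swap_pair k * s)%g _]permM swap_pair_even swap_pair_odd eqxx skewA.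
rewrite !mulNr mulrN opprK; congr (_ * (_ * _)); apply: eq_bigr.
by move=> l /negPf nlk; rewrite ![(swap_pair k * s)%g _]permM swap_pair_even swap_pair_odd nlk.
Qed.

Lemma pf_term_swap_pairs k l s : pf_term (swap_pairs k l * s) = pf_term s.
Proof.
rewrite /pf_term odd_swap_pairs; congr (_ * _).
rewrite [RHS](reindex_inj (@perm_inj _ (tperm k l))) /=; apply: eq_bigr => m _.
by rewrite ![(swap_pairs k l * s)%g _]permM swap_pairs_even swap_pairs_odd.
Qed.

Lemma matching_rep s : exists u,
  [/\ matching_perm u, (partner p ^ u = partner p ^ s)%g & pf_term u = pf_term s].
Proof.
(* The weights [p - k] are positive and decrease with [k], so that [V] drops both when a reversed
   pair is corrected and when two pairs in the wrong order are exchanged. *)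
pose V (u : 'S_(p.*2)) := (\sum_(k < p) (p - k) * u (ord_even k))%N.
have [d le_d] := ubnP (V s); elim: d s le_d => // d IHd s; rewrite ltnS => le_d.
have [ms | ] := boolP (matching_perm s); first by exists s.
rewrite negb_and => /orP[] /forallPn[k].
  rewrite -leqNgt => le1.
  have lt1 : (s (ord_odd k) < s (ord_even k))%N.
    rewrite ltn_neqAle le1 andbT; apply/eqP => /val_inj/perm_inj/eqP.
    by rewrite eq_pair.
  have [|u [mu pu tu]] := IHd (swap_pair k * s)%g.
    apply: (leq_trans _ le_d); rewrite /V (bigD1 k) //= [leqRHS](bigD1 k) //=.
    rewrite [(swap_pair k * s)%g _]permM swap_pair_even eqxx -addSn leq_add //.
      by rewrite ltn_pmul2l // subn_gt0.
    by apply: leq_sum => l /negPf nlk; rewrite [(swap_pair k * s)%g _]permM swap_pair_even nlk.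
  by exists u; split=> //; rewrite ?pu ?tu ?pf_term_swap_pair // conjgM partner_swap_pair.
case/forallPn=> l; rewrite negb_imply -leqNgt => /andP[ltkl le1].
have nkl : l != k by rewrite -val_eqE /= gtn_eqF.
have lt1 : (s (ord_even l) < s (ord_even k))%N.
  rewrite ltn_neqAle le1 andbT; apply/eqP => /val_inj/perm_inj/eqP.
  by rewrite eq_pair (negPf nkl).
have [|u [mu pu tu]] := IHd (swap_pairs k l * s)%g.
  apply: (leq_trans _ le_d); rewrite /V (bigD1 k) //= [leqRHS](bigD1 k) //=.
  rewrite (bigD1 l) //= [in leqRHS](bigD1 l) //=.
  rewrite ![(swap_pairs k l * s)%g _]permM !swap_pairs_even tpermL tpermR !addnA -addSn leq_add //.
    by have := ltn_ord l; nia.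
  apply: leq_sum => m /andP[nmk nml].
  by rewrite [(swap_pairs k l * s)%g _]permM swap_pairs_even tpermD // eq_sym.
by exists u; split=> //; rewrite ?pu ?tu ?pf_term_swap_pairs // conjgM partner_swap_pairs.
Qed.

End PfaffianTerms.

Lemma matching_mins p (s : 'S_(p.*2)) : matching_perm s ->
  forall x, (x \in [seq s (ord_even k) | k <- enum 'I_p]) = (x < (partner p ^ s)%g x)%N.
Proof.
case/andP=> /forallP lt_eo _ x; rewrite -(permKV s x); move: (s^-1%g x) => i.
rewrite (map_comp s) (mem_map (@perm_inj _ s)) permJ partnerE.
case: (ord_pairP i) => k; rewrite ?partner_even ?partner_odd.
  by rewrite lt_eo map_f // mem_enum.
rewrite ltnNge ltnW ?lt_eo //=; apply/mapP => -[l _ /eqP].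
by rewrite eq_pair.
Qed.

(** The involution determines the set of minima of the pairs; a matching permutation lists them in
    increasing order at the even places, and the involution then gives the odd places. *)
Lemma matching_uniq p (s u : 'S_(p.*2)) : matching_perm s -> matching_perm u ->
  (partner p ^ s = partner p ^ u)%g -> s = u.
Proof.
move=> ms mu eqsu.
have srt v : matching_perm v ->
    sorted (fun i j : 'I_(p.*2) => i < j)%N [seq v (ord_even k) | k <- enum 'I_p].
  case/andP=> _ /forallP mono; rewrite sorted_map.
  apply: (@sub_sorted _ (relpre val ltn)); last first.
    by rewrite -sorted_map val_enum_ord iota_ltn_sorted.
  by move=> k l /= ltkl; move/forallP/(_ l)/implyP: (mono k); apply.
have eqe : [seq s (ord_even k) | k <- enum 'I_p] = [seq u (ord_even k) | k <- enum 'I_p].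
  apply: (irr_sorted_eq _ _ (srt _ ms) (srt _ mu)).
  - by move=> a b c; apply: ltn_trans.
  - by move=> a; apply: ltnn.
  - by move=> x; rewrite !matching_mins // eqsu.
have even_eq k : s (ord_even k) = u (ord_even k).
  by move/eq_in_map: eqe; apply; rewrite mem_enum.
apply/permP=> i; case: (ord_pairP i) => k //.
have E (v : 'S_(p.*2)) : v (ord_odd k) = (partner p ^ v)%g (v (ord_even k)).
  by rewrite permJ partnerE partner_even.
by rewrite !E eqsu even_eq.
Qed.

(* Swapping two indices with equal rows changes the sign of each term; after
   reordering the pairs this is an involution on matchings. *)
Lemma pfaffian_alternate p (A : 'M[int]_(p.*2)) (i j : 'I_(p.*2)) :
  (forall x y, A x y = - A y x) -> i != j -> (forall x, A i x = A j x) ->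
  pfaffian A = 0.
Proof.
move=> skewA nij eqij.
pose norm s := odflt s [pick u | matching_perm u && (partner p ^ u == partner p ^ s)%g].
have normP s : [/\ matching_perm (norm s), (partner p ^ norm s = partner p ^ s)%g
    & pf_term A (norm s) = pf_term A s].
  have [u [mu pu tu]] := matching_rep skewA s.
  rewrite /norm; case: pickP => [v /andP[mv /eqP pv] | /(_ u)]; last first.
    by rewrite mu pu eqxx.
  by rewrite (matching_uniq mv mu) //= pv.
pose h s := norm (s * tperm i j)%g.
have hK s : matching_perm s -> h (h s) = s.
  move=> ms; have [m1 p1 _] := normP (s * tperm i j)%g.
  have [m2 p2 _] := normP (h s * tperm i j)%g.
  apply: matching_uniq => //; rewrite p2 conjgM p1 -conjgM -mulgA tperm2.
  by rewrite mulg1.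
have term_h s : pf_term A (h s) = - pf_term A s.
  have [_ _ ->] := normP (s * tperm i j)%g; rewrite /pf_term.
  rewrite odd_permM odd_tperm nij /= addbT signrN mulNr; congr (- (_ * _)).
  have row x y : A (tperm i j x) y = A x y by case: tpermP => // ->.
  apply: eq_bigr => k _.
  by rewrite !permM row skewA row -skewA.
have : pfaffian A = - pfaffian A; last by lia.
rewrite {1}/pfaffian (reindex_onto h h hK) /=.
rewrite /pfaffian -sumrN; apply: eq_big => [s | s _]; last exact: term_h.
have [mh _ _] := normP (s * tperm i j)%g; rewrite -/(h s) in mh; rewrite mh /=.
apply/eqP/idP => [<- | /hK //].
by have [] := normP (h s * tperm i j)%g.
Qed.

Lemma pfaffian_map (R S : comNzRingType) (f : {rmorphism R -> S}) p (A : 'M[R]_(p.*2)) :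
  pfaffian (map_mx f A) = f (pfaffian A).
Proof.
rewrite /pfaffian rmorph_sum; apply: eq_bigr => s _.
rewrite rmorphM rmorph_sign rmorph_prod; congr (_ * _).
by apply: eq_bigr => k _; rewrite mxE.
Qed.

(** Integer entries are essential to the method: a repeated row gives Pf = -Pf, which forces Pf = 0
    over the integers but says nothing in characteristic 2. *)
Definition symplectic_mx T : 'M[int]_(T.*2) :=
  \matrix_(i, j) (if j == partner_fun i then (-1) ^+ odd i else 0).

Lemma symplectic_skew T i j : symplectic_mx T i j = - symplectic_mx T j i.
Proof.
rewrite !mxE; have -> : (i == partner_fun j) = (j == partner_fun i).
  by rewrite -(inv_eq (@partner_funK T)) eq_sym.
case: eqP => [-> | _]; last by rewrite oppr0.
by case: (ord_pairP i) => k; rewrite ?partner_even ?partner_odd /= odd_double ?opprK.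
Qed.

Lemma pfaffian_symplectic p : pfaffian (symplectic_mx p) = 1.
Proof.
have m1 : matching_perm (1%g : 'S_(p.*2)).
  apply/andP; split; apply/forallP => k; first by rewrite !perm1 /=.
  by apply/forallP => l; rewrite !perm1 /= ltn_double; apply/implyP.
rewrite /pfaffian (bigD1 1%g) //= odd_perm1 mul1r.
rewrite [X in _ + X]big1 ?addr0.
  by apply: big1 => k _; rewrite !perm1 mxE partner_even eqxx /= odd_double.
move=> s /andP[ms ns].
have [k /eqP nk | all_eq] := pickP (fun k =>
    s (ord_odd k) != partner_fun (s (ord_even k))).
  by rewrite (bigD1 k) //= mxE; case: eqP => // _; rewrite mul0r mulr0.
case/eqP: ns; apply: matching_uniq => //; rewrite conjg1.
apply/permP => x; rewrite -(permKV s x); move: (s^-1%g x) => i.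
rewrite permJ !partnerE; case: (ord_pairP i) => k;
  rewrite ?partner_even ?partner_odd; have /negbFE/eqP -> := all_eq k => //.
by rewrite partner_funK.
Qed.

(* Cauchy-Binet for the Pfaffian of Y^T J Y, before collecting equal minors. *)
Lemma pfaffian_congr (R : comNzRingType) p T (J : 'M[R]_T) (y : 'I_T -> 'I_(p.*2) -> R) :
  pfaffian (\matrix_(i, j) \sum_r \sum_r' J r r' * (y r i * y r' j)) =
  \sum_(rho : {ffun 'I_(p.*2) -> 'I_T})
     (\prod_i y (rho i) i) * pfaffian (mxsub rho rho J).
Proof.
under [RHS]eq_bigr do rewrite /pfaffian big_distrr /=.
rewrite exchange_big /= /pfaffian; apply: eq_bigr => s _.
under [RHS]eq_bigr do rewrite mulrCA.
rewrite -big_distrr /=; congr (_ * _).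
pose G k (r : 'I_T * 'I_T) :=
  J r.1 r.2 * (y r.1 (s (ord_even k)) * y r.2 (s (ord_odd k))).
transitivity (\prod_(k < p) \sum_(r : 'I_T * 'I_T) G k r).
  by apply: eq_bigr => k _; rewrite mxE pair_big.
rewrite bigA_distr_bigA /=.
(* Choosing a pair of rows for every [k] amounts to choosing one row for every index, read through
   [s]. *)
pose h (rho : {ffun 'I_(p.*2) -> 'I_T}) : {ffun 'I_p -> 'I_T * 'I_T} :=
  [ffun k => (rho (s (ord_even k)), rho (s (ord_odd k)))].
pose h' (g : {ffun 'I_p -> 'I_T * 'I_T}) : {ffun 'I_(p.*2) -> 'I_T} :=
  [ffun i => let j := s^-1%g i in
             if odd j then (g (half_ord j)).2 else (g (half_ord j)).1].
rewrite (reindex h) /=; last first.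
  exists h' => [rho _ | g _]; apply/ffunP => x; rewrite !ffunE /=.
    rewrite -{4}(permKV s x); case: (ord_pairP (s^-1%g x)) => k;
    by rewrite /= odd_double ?half_even ?half_odd ffunE.
  by rewrite !permK /= !odd_double /= half_even half_odd; case: (g x).
apply: eq_bigr => rho _.
rewrite (reindex_inj (@perm_inj _ s)) /= big_pairing -big_split /=.
by apply: eq_bigr => k _; rewrite ffunE /G /= mxE mulrC.
Qed.

(** This spares the diagonal of $Y^T J_0 Y$, whose vanishing does not follow from skewness alone in
    characteristic 2. *)
Lemma eq_pfaffian_offdiag (R : comNzRingType) p (A B : 'M[R]_(p.*2)) :
  (forall i j, i != j -> A i j = B i j) -> pfaffian A = pfaffian B.
Proof.
move=> eqAB; apply: eq_bigr => s _; congr (_ * _); apply: eq_bigr => k _.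
by rewrite eqAB // (inj_eq perm_inj) eq_pair.
Qed.

(** * A symplectic parametrization *)

Lemma tnth_increasing n s (c : s.-tuple 'I_n) (i j : 'I_s) :
  increasing c -> (i < j)%N -> (tnth c i < tnth c j)%N.
Proof.
move=> inc ltij; have x0 := tnth c i.
have nthE (k : 'I_s) : val (tnth c k) = nth 0 (map val c) k.
  by rewrite (tnth_nth x0) (nth_map x0) ?size_tuple.
rewrite !nthE (sorted_ltn_nth ltn_trans) // !inE size_map size_tuple //.
Qed.

Lemma tnth_increasing_leq n s (c : s.-tuple 'I_n) (i j : 'I_s) :
  increasing c -> (i <= j)%N -> (tnth c i <= tnth c j)%N.
Proof.
move=> inc; rewrite leq_eqVlt => /orP[/eqP/val_inj -> // | lt].
by rewrite ltnW // tnth_increasing.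
Qed.

Lemma tnth_increasing_inj n s (c : s.-tuple 'I_n) : increasing c -> injective (tnth c).
Proof.
move=> inc i j eqij; apply/val_inj; have [lt | lt | //] := ltngtP (val i) (val j).
  by have := tnth_increasing inc lt; rewrite eqij ltnn.
by have := tnth_increasing inc lt; rewrite eqij ltnn.
Qed.

Lemma pf_leP n t s (a : t.*2.-tuple 'I_n) (b : s.*2.-tuple 'I_n) :
  reflect (exists le_st : (s.*2 <= t.*2)%N,
             forall i, (tnth a (widen_ord le_st i) <= tnth b i)%N)
          (pf_le a b).
Proof.
rewrite /pf_le all2E; apply: (iffP and3P) => [[le_st _ /allP ab] | [le_st ab]].
  rewrite -leq_double in le_st; exists le_st => i; have x0 := tnth b i.
  have /ab /= : (tnth a (widen_ord le_st i), tnth b i) \in zip (take s.*2 a) b.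
    have -> : (tnth a (widen_ord le_st i), tnth b i) = nth (x0, x0) (zip (take s.*2 a) b) i.
      rewrite nth_zip ?nth_take ?(tnth_nth x0) //=.
      by rewrite size_takel size_tuple.
    by rewrite mem_nth // size_zip size_takel size_tuple ?minnn.
  by [].
have szE : size (take s.*2 a) = size b by rewrite size_takel size_tuple.
split; [by rewrite -leq_double | by rewrite szE | apply/allP => /= -[x y] /(nthP (x, y))].
case=> i; rewrite size_zip szE minnn size_tuple => lti.
rewrite nth_zip // nth_take // => -[<- <-].
by have := ab (Ordinal lti); rewrite !(tnth_nth x) /= (set_nth_default x y) // size_tuple.
Qed.

Lemma dhomog_bigprod (R : nzRingType) N (I : Type) (r : seq I) (P : pred I)
    (F : I -> {mpoly R[N]}) (d : I -> nat) :
  (forall i, P i -> F i \is (d i).-homog) ->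
  \prod_(i <- r | P i) F i \is (\sum_(i <- r | P i) d i)%N.-homog.
Proof.
apply: (big_ind2 (fun (q : {mpoly R[N]}) e => q \is e.-homog)); first exact: dhomog1.
by move=> q1 d1 q2 d2; apply: dhomogM.
Qed.

Section IndexY.
Variable n : nat.

Lemma y_index_subproof T (k : 'I_T) (j : 'I_n) : (k * n + j < T * n)%N.
Proof. have := ltn_ord k; have := ltn_ord j; nia. Qed.

(** Row-major numbering: the first variables being the largest in the lexicographic comparison,
    upper rows dominate, and within a row the left entries do. This makes the diagonal terms
    lead. *)
Definition y_index T (k : 'I_T) (j : 'I_n) : 'I_(T * n) :=
  Ordinal (y_index_subproof k j).

Lemma y_index_eq T (k l : 'I_T) (i j : 'I_n) :
  (y_index k i == y_index l j) = (k == l) && (i == j).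
Proof.
apply/eqP/andP => [/(congr1 val) /= eqv | [/eqP -> /eqP -> //]].
have ltj := ltn_ord j; have lti := ltn_ord i; have npos : (0 < n)%N by lia.
split; apply/eqP/val_inj.
  have := congr1 (divn^~ n) eqv.
  by rewrite /= !divnMDl // !(divn_small (ltn_ord _)) // !addn0.
have := congr1 (modn^~ n) eqv.
by rewrite /= !modnMDl !(modn_small (ltn_ord _)).
Qed.

Lemma y_index_surj T (e : 'I_(T * n)) : exists k j, e = y_index k j.
Proof.
have lte := ltn_ord e; have npos : (0 < n)%N by case: (posnP n) => // n0; move: lte; rewrite {2}n0 muln0.
have ltk : (e %/ n < T)%N by rewrite ltn_divLR.
exists (Ordinal ltk), (Ordinal (ltn_pmod e npos)); apply/val_inj.
by rewrite /= -divn_eq.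
Qed.

Lemma y_index_lt T (k l : 'I_T) (i j : 'I_n) :
  (y_index k i < y_index l j)%N -> (k < l)%N || (k == l) && (i < j)%N.
Proof.
rewrite /= -val_eqE /=; have := ltn_ord i; have := ltn_ord j.
by case: ltngtP => [//|gt|->] /=; nia.
Qed.

End IndexY.

Section Parametrization.
Variables (K : fieldType) (n t : nat) (alpha : t.*2.-tuple 'I_n).

Definition y_var (k : 'I_(t.*2)) (j : 'I_n) : {mpoly K[t.*2 * n]} :=
  if (tnth alpha k <= j)%N then 'X_(y_index k j) else 0.

Definition symplectic_form (i j : 'I_n) : {mpoly K[t.*2 * n]} :=
  \sum_r \sum_r' (symplectic_mx t r r')%:~R * (y_var r i * y_var r' j).

(* X |-> Y^T J Y, where the entry (k, j) of Y vanishes if j < alpha_k. *)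
Definition param : {mpoly K[#|{: indet n}|]} -> {mpoly K[t.*2 * n]} :=
  mmap (@mpolyC _ K)
    (fun e => symplectic_form (val (enum_val e)).1 (val (enum_val e)).2).

HB.instance Definition _ := GRing.RMorphism.on param.

Lemma symplectic_form_skew i j : symplectic_form i j = - symplectic_form j i.
Proof.
rewrite /symplectic_form exchange_big -sumrN; apply: eq_bigr => r _.
rewrite -sumrN; apply: eq_bigr => r' _.
by rewrite symplectic_skew rmorphN mulNr; congr (- (_ * _)); apply: mulrC.
Qed.

Lemma Xmon_indet (p : indet n) : Xmon (val p).1 (val p).2 = mon_of p.
Proof. by rewrite /Xmon -surjective_pairing valK. Qed.

Lemma paramX (p : indet n) : param 'X_[mon_of p] = symplectic_form (val p).1 (val p).2.
Proof. by rewrite /param mmapX mmap1U enum_rankK. Qed.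

Lemma param_skewX i j : i != j -> param (skewX K n i j) = symplectic_form i j.
Proof.
move=> nij; rewrite mxE; case: ltngtP => [lt | gt | /val_inj/eqP]; last by rewrite (negPf nij).
  pose p : indet n := exist _ (i, j) lt.
  exact: etrans (congr1 (fun m => param 'X_[m]) (Xmon_indet p)) (paramX p).
pose p : indet n := exist _ (j, i) gt.
rewrite rmorphN symplectic_form_skew; congr (- _).
exact: etrans (congr1 (fun m => param 'X_[m]) (Xmon_indet p)) (paramX p).
Qed.

Lemma param_Pf s (b : s.*2.-tuple 'I_n) : increasing b ->
  param (Pf K b) = \sum_(rho : {ffun 'I_(s.*2) -> 'I_(t.*2)})
     (\prod_i y_var (rho i) (tnth b i)) * (pfaffian (mxsub rho rho (symplectic_mx t)))%:~R.
Proof.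
move=> inc; rewrite /Pf -pfaffian_map.
rewrite -(eq_pfaffian_offdiag (A := \matrix_(i, j) symplectic_form (tnth b i) (tnth b j))).
  have := pfaffian_congr (map_mx intr (symplectic_mx t)) (fun r i => y_var r (tnth b i)).
  rewrite (_ : (\matrix_(i, j) _) =
    (\matrix_(i, j) symplectic_form (tnth b i) (tnth b j))); last first.
    apply/matrixP => i j; rewrite !mxE; apply: eq_bigr => r _.
    by apply: eq_bigr => r' _; rewrite !mxE.
  move->; apply: eq_bigr => rho _; congr (_ * _).
  rewrite -[RHS]pfaffian_map; congr pfaffian.
  by apply/matrixP => i j; rewrite !mxE.
move=> i j nij; rewrite !mxE -[RHS]/(param _) -param_skewX ?mxE //.
by rewrite (inj_eq (tnth_increasing_inj inc)).
Qed.

Lemma pfaffian_symplectic_repeat s (rho : {ffun 'I_(s.*2) -> 'I_(t.*2)}) :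
  ~~ injectiveb rho -> pfaffian (mxsub rho rho (symplectic_mx t)) = 0.
Proof.
case/injectivePn=> i [j nij eqij]; apply: (@pfaffian_alternate _ _ i j) => //.
  by move=> x y; rewrite [LHS]mxE [in RHS]mxE symplectic_skew.
by move=> x; rewrite !mxE eqij.
Qed.

Definition y_mon s (rho : 'I_s -> 'I_(t.*2)) (b : s.-tuple 'I_n) : 'X_{1..t.*2 * n} :=
  (\sum_i U_(y_index (rho i) (tnth b i)))%MM.

Lemma y_monE s (rho : 'I_s -> 'I_(t.*2)) (b : s.-tuple 'I_n) k j :
  y_mon rho b (y_index k j) = (\sum_i ((rho i == k) && (tnth b i == j)))%N.
Proof. by rewrite mnm_sumE; apply: eq_bigr => i _; rewrite mnm1E y_index_eq. Qed.

Lemma prod_y_var s (rho : 'I_s -> 'I_(t.*2)) (b : s.-tuple 'I_n) :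
  \prod_i y_var (rho i) (tnth b i) =
  if [forall i, (tnth alpha (rho i) <= tnth b i)%N] then 'X_[y_mon rho b] else 0.
Proof.
case: ifPn => [/forallP le | /forallPn[i /negPf lt]].
  by rewrite /y_mon -mprodXE; apply: eq_bigr => i _; rewrite /y_var le.
by rewrite (bigD1 i) //= /y_var lt mul0r.
Qed.

(** Pigeonhole: the [i + 1] indices up to [i] cannot be sent injectively to values below [i]. *)
Lemma inj_rho_bound s (rho : 'I_s -> 'I_(t.*2)) (i : 'I_s) : injective rho ->
  exists2 j : 'I_s, (j <= i)%N & (i <= rho j)%N.
Proof.
move=> injr; case: (pickP (fun j : 'I_s => (j <= i)%N && (i <= rho j)%N)) => [j /andP[? ?] | none].
  by exists j.
have lt (j : 'I_i.+1) : (rho (widen_ord (ltn_ord i) j) < i)%N.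
  have := none (widen_ord (ltn_ord i) j); rewrite /= -ltnS ltn_ord /=.
  by move/negbT; rewrite -ltnNge.
have := @leq_card _ _ (fun j => Ordinal (lt j)).
rewrite !card_ord ltnn => absurd; suff: false by [].
apply: absurd => j l /(congr1 val) /= /val_inj/injr/(congr1 val) /= eqjl.
exact: val_inj.
Qed.

Hypothesis alpha_inc : increasing alpha.

Lemma param_Pf_eq0 s (b : s.*2.-tuple 'I_n) :
  increasing b -> ~~ pf_le alpha b -> param (Pf K b) = 0.
Proof.
move=> inc nle; rewrite param_Pf // big1 // => rho _.
have [/injectiveP injr | ninj] := boolP (injectiveb rho); last first.
  by rewrite pfaffian_symplectic_repeat // mulr0.
rewrite prod_y_var; case: ifPn => [/forallP le | _]; last by rewrite mul0r.
case/negP: nle; apply/pf_leP.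
have le_st : (s.*2 <= t.*2)%N by have := leq_card _ injr; rewrite !card_ord.
(* alpha_i <= alpha_(rho j) <= b_j <= b_i, the middle inequality because the term of [rho]
   survives. *)
exists le_st => i; have [j leji leij] := inj_rho_bound i injr.
apply: leq_trans (tnth_increasing_leq inc leji); apply: leq_trans (le j).
exact: tnth_increasing_leq.
Qed.

Lemma mdeg_y_mon s (rho : 'I_s -> 'I_(t.*2)) (b : s.-tuple 'I_n) :
  mdeg (y_mon rho b) = s.
Proof.
rewrite mdeg_sum (eq_bigr (fun=> 1%N)) => [|i _]; last by rewrite mdeg1.
by rewrite sum1_card card_ord.
Qed.

(** Let [i] be the first index moved by [rho]. Injectivity makes the rows above [i] agree, and in
    row [i] the columns left of [b_i] agree since they could only come from fixed indices. The
    variable y_(i, b_i) itself then occurs on the right-hand side only. *)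
Lemma y_mon_lt s (rho : 'I_s -> 'I_(t.*2)) (b : s.-tuple 'I_n) (le_st : (s <= t.*2)%N) :
  increasing b -> injective rho -> (exists i, rho i != widen_ord le_st i) ->
  (y_mon rho b < y_mon (widen_ord le_st) b)%O.
Proof.
move=> inc injr [i0 ni0]; apply/(ltmcP (etrans (mdeg_y_mon _ _) (esym (mdeg_y_mon _ _)))).
case: (@arg_minnP _ i0 (fun i => rho i != widen_ord le_st i) val ni0) => i ni min_i.
have fixr (l : 'I_s) : (l < i)%N -> rho l = widen_ord le_st l.
  by move=> ltli; apply/eqP; apply: contraTT ltli => nl; rewrite -leqNgt min_i.
have fixE (l k : 'I_s) : (k < i)%N -> (rho l == widen_ord le_st k) = (l == k).
  by move=> ltk; rewrite -(fixr k ltk) (inj_eq injr).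
have widenE (l k : 'I_s) : (widen_ord le_st l == widen_ord le_st k) = (l == k) by [].
exists (y_index (widen_ord le_st i) (tnth b i)) => [e | ].
  have [k [j ->]] := y_index_surj e => /y_index_lt ltkj.
  rewrite !y_monE; apply: eq_bigr => l _; congr nat_of_bool.
  case/orP: ltkj => [ltki | /andP[/eqP -> ltj]].
    have ltks : (k < s)%N by apply: ltn_trans ltki _; rewrite /= ltn_ord.
    have -> : k = widen_ord le_st (Ordinal ltks) by apply: val_inj.
    by rewrite fixE // widenE.
  have [eqj | _] := eqVneq (tnth b l) j; rewrite ?andbF // !andbT.
  have ltli : (l < i)%N.
    rewrite ltnNge; apply/negP => leil.
    by have := tnth_increasing_leq inc leil; rewrite eqj leqNgt ltj.
  by rewrite fixr.
rewrite !y_monE [X in (X < _)%N]big1 => [|l _]; last first.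
  apply/eqP; rewrite eqb0; apply/negP => /andP[/eqP rl /eqP/(tnth_increasing_inj inc) li].
  by move: ni; rewrite -rl li eqxx.
by rewrite (bigD1 i) //= !eqxx.
Qed.

Lemma mlead_eq_msupp N (q : {mpoly K[N]}) m :
  q@_m != 0 -> (forall m', (m < m')%O -> q@_m' = 0) -> mlead q = m.
Proof.
move=> qm high; apply/le_anti; rewrite msupp_le_mlead ?mcoeff_msupp // andbT.
have nz : q != 0 by apply: contraNneq qm => ->; rewrite mcoeff0.
rewrite leNgt; apply/negP => /high /eqP; rewrite mcoeff_eq0.
by rewrite mlead_supp.
Qed.

Lemma mlead_param_Pf s (b : s.*2.-tuple 'I_n) (le_st : (s.*2 <= t.*2)%N) :
  increasing b -> (forall i, (tnth alpha (widen_ord le_st i) <= tnth b i)%N) ->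
  mlead (param (Pf K b)) = y_mon (widen_ord le_st) b /\ param (Pf K b) != 0.
Proof.
move=> inc le_ab; set m0 := y_mon _ _.
(* At [m0] and above, only the standard embedding of rows contributes; the submatrix it selects is
   again a standard symplectic matrix, of Pfaffian 1. *)
have coefE m : (m0 <= m)%O -> (param (Pf K b))@_m = (m == m0)%:R.
  move=> lem; rewrite param_Pf // raddf_sum /=.
  pose rho0 : {ffun 'I_(s.*2) -> 'I_(t.*2)} := [ffun i => widen_ord le_st i].
  have rho0E : y_mon rho0 b = m0.
    by rewrite /y_mon; apply: eq_bigr => i _; rewrite ffunE.
  rewrite (bigD1 rho0) //= [X in _ + X]big1 ?addr0 => [|rho nrho].
    rewrite prod_y_var ifT; last by apply/forallP => i; rewrite ffunE.
    have -> : mxsub rho0 rho0 (symplectic_mx t) = symplectic_mx s.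
      apply/matrixP => i j; rewrite !mxE !ffunE; congr (if _ then _ else _).
      by rewrite -!val_eqE /= /partner_fun; case: ifP => //=; rewrite (fun_if val).
    by rewrite pfaffian_symplectic mulr1 mcoeffX rho0E eq_sym.
  have [/injectiveP injr | ninj] := boolP (injectiveb rho); last first.
    by rewrite pfaffian_symplectic_repeat // mulr0 mcoeff0.
  rewrite prod_y_var; case: ifPn => _; last by rewrite mul0r mcoeff0.
  rewrite mulrzr raddfMz /= mcoeffX; case: eqP => [eqm | _]; last by rewrite mul0rz.
  case/negP: (le_gtF lem); rewrite -eqm; apply: y_mon_lt => //.
  apply/existsP; rewrite -negb_forall; apply: contraNN nrho => /forallP eqr.
  by apply/eqP/ffunP => i; rewrite ffunE; apply/eqP.
have nz : (param (Pf K b))@_m0 != 0 by rewrite coefE // eqxx oner_neq0.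
split; last by apply: contraNneq nz => ->; rewrite mcoeff0.
apply: mlead_eq_msupp => // m ltm.
by rewrite coefE ?ltW // eq_sym lt_eqF.
Qed.

Lemma symplectic_form_dhomog i j : symplectic_form i j \is 2.-homog.
Proof.
have y_homog k l : y_var k l \is 1.-homog.
  by rewrite /y_var; case: ifP => _; rewrite ?dhomog0 // dhomogX /= mdeg1.
apply: rpred_sum => r _; apply: rpred_sum => r' _.
rewrite mulrC mulrzr; apply: rpredMz; exact: dhomogM (y_homog _ _) (y_homog _ _).
Qed.

Lemma param_dhomog m : param 'X_[m] \is (2 * mdeg m).-homog.
Proof.
rewrite /param mmapX /mmap1 mdegE big_distrr /=.
by apply: dhomog_bigprod => e _; apply: dhomogMn; apply: symplectic_form_dhomog.
Qed.

Lemma paramZ c q : param (c *: q) = c *: param q.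
Proof. by rewrite /param mmapZ mul_mpolyC. Qed.

(** [param] doubles degrees, so the component of degree [2 * d] of the image comes from the
    component of degree [d] alone. *)
Lemma param_pihomog d f : param f = 0 -> param (pihomog mdeg d f) = 0.
Proof.
move=> f0; have := congr1 (pihomog mdeg (2 * d)%N) f0; rewrite pihomog0 => <-.
rewrite {2}[f]mpolyE pihomogE !rmorph_sum raddf_sum /= big_mkcond /=.
apply: eq_bigr => m _; rewrite !paramZ linearZ /=.
have := param_dhomog m; have [<- | nd] := eqVneq (mdeg m) d => hom.
  by rewrite pihomog_dE.
by rewrite (@pihomog_ne0 _ _ _ (2 * mdeg m)%N) ?scaler0 // eqn_pmul2l.
Qed.

Lemma Pf_dhomog s (b : s.*2.-tuple 'I_n) : increasing b -> Pf K b \is s.-homog.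
Proof.
move=> inc; apply: rpred_sum => u _.
have hom : \prod_(k < s) mxsub (tnth b) (tnth b) (skewX K n) (u (ord_even k)) (u (ord_odd k))
   \is s.-homog.
  suff: \prod_(k < s) mxsub (tnth b) (tnth b) (skewX K n) (u (ord_even k)) (u (ord_odd k))
      \is (\sum_(k < s) 1)%N.-homog by rewrite sum1_card card_ord.
  apply: dhomog_bigprod => k _; set i := u _; set j := u _.
  have nij : tnth b i != tnth b j.
    by rewrite (inj_eq (tnth_increasing_inj inc)) (inj_eq perm_inj) eq_pair.
  have X1 (p : indet n) : 'X_[K, Xmon (val p).1 (val p).2] \is 1.-homog.
    by rewrite Xmon_indet dhomogX /= mdeg1.
  rewrite !mxE; case: ltngtP => [lt | gt | /val_inj/eqP]; last by rewrite (negPf nij).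
    exact: (X1 (exist _ (tnth b i, tnth b j) lt)).
  rewrite rpredN; exact: (X1 (exist _ (tnth b j, tnth b i) gt)).
by rewrite mulr_sign; case: (odd_perm u); rewrite ?rpredN.
Qed.

End Parametrization.

(** * The tableau of a monomial *)

Section SymmetricMatrix.
Variable n : nat.
Implicit Type m : 'X_{1..#|{: indet n}|}.

Definition sym_mat m (x y : nat) : nat :=
  (\sum_(p : indet n) m (enum_rank p) *
     (((val p).1 == x :> nat) && ((val p).2 == y :> nat) ||
      ((val p).1 == y :> nat) && ((val p).2 == x :> nat)))%N.

Lemma sym_mat_sym m x y : sym_mat m x y = sym_mat m y x.
Proof. by apply: eq_bigr => p _; rewrite orbC. Qed.

Lemma sym_mat_diag m x : sym_mat m x x = 0%N.
Proof.
apply: big1 => p _; rewrite orbb; case: andP => [[/eqP <- /eqP eqp]|]; last by rewrite muln0.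
by have := valP p; rewrite /= -eqp ltnn.
Qed.

Lemma sym_mat_gt0 m x y : (0 < sym_mat m x y)%N ->
  exists2 p : indet n, (0 < m (enum_rank p))%N &
    ((val p).1 = x :> nat /\ (val p).2 = y :> nat) \/
    ((val p).1 = y :> nat /\ (val p).2 = x :> nat).
Proof.
rewrite lt0n sum_nat_eq0 => /forallPn[p]; rewrite /= muln_eq0 negb_or eqb0 negbK -lt0n.
by case/andP=> mp /orP[] /andP[/eqP ? /eqP ?]; exists p => //; [left | right].
Qed.

Lemma sym_mat_indet m (p : indet n) : sym_mat m (val p).1 (val p).2 = m (enum_rank p).
Proof.
rewrite /sym_mat (bigD1 p) //= !eqxx /= muln1 big1 ?addn0 // => q nqp.
apply/eqP; rewrite muln_eq0 eqb0; apply/orP; right.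
have ltp := valP p; have ltq := valP q; rewrite /= in ltp ltq.
rewrite negb_or; apply/andP; split; apply: contraNN nqp => /andP[/eqP e1 /eqP e2].
  by rewrite -val_eqE -pair_eqE /= /pair_eq -!val_eqE /= e1 e2 !eqxx.
by move: ltq; rewrite e1 e2 ltnNge ltnW.
Qed.

Lemma sym_mat_sum m : (\sum_(u < n) \sum_(v < n) sym_mat m u v = 2 * mdeg m)%N.
Proof.
rewrite mdegE big_distrr (reindex _ (onW_bij _ (@enum_rank_bij (indet n)))) /=.
under eq_bigr do rewrite exchange_big /=.
rewrite exchange_big /=; apply: eq_bigr => p _.
have ltp := valP p; rewrite /= in ltp.
under eq_bigr do rewrite -big_distrr /=.
rewrite -big_distrr /= mulnC; congr (_ * _)%N.
rewrite pair_big /= (bigD1 ((val p).1, (val p).2)) //= !eqxx /=.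
rewrite (bigD1 ((val p).2, (val p).1)) /= ?eqxx ?orbT; last first.
  by rewrite -pair_eqE /= negb_and -!val_eqE /= gtn_eqF.
rewrite big1 //= => -[u v] /= /andP[n1 n2]; apply/eqP; rewrite eqb0.
by rewrite negb_or; apply/andP; split; [move: n1 | move: n2];
  apply: contraNN => /andP[/eqP/val_inj <- /eqP/val_inj <-].
Qed.

End SymmetricMatrix.

Lemma find_mono_lt n (f : nat -> nat) c x :
  (forall u v, (u <= v)%N -> (f u <= f v)%N) -> f 0%N = 0%N -> (x <= n)%N ->
  (find (fun u => c < f u.+1)%N (iota 0 n) < x)%N = (c < f x)%N.
Proof.
move=> mono f0 lex; set a := (fun u => _); set i := find _ _.
apply/idP/idP => [lti | ltc].
  have ltin : (i < n)%N by apply: leq_trans lti lex.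
  have := @nth_find _ 0%N a (iota 0 n); rewrite has_find size_iota -/i => /(_ ltin).
  by rewrite nth_iota //= => ltc; apply: leq_trans ltc (mono _ _ lti).
case: x lex ltc => [|x] lex ltc; first by rewrite f0 in ltc.
rewrite ltnS leqNgt; apply/negP => lti.
by have := before_find 0%N lti; rewrite nth_iota // /a ltc.
Qed.

Lemma find_anti_lt t (f : nat -> nat) c i :
  (forall u v, (u <= v)%N -> (f v <= f u)%N) ->
  (i < find (fun u => f u <= c)%N (iota 0 t))%N = (i < t)%N && (c < f i)%N.
Proof.
move=> anti; set a := (fun u => _); set j := find _ _.
have lejt : (j <= t)%N by rewrite -[t in leqRHS](size_iota 0) find_size.
apply/idP/andP => [ltij | [ltit ltc]].
  have ltit : (i < t)%N by apply: leq_trans ltij lejt.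
  by split=> //; have := before_find 0%N ltij; rewrite nth_iota // /a ltnNge => ->.
rewrite ltnNge; apply/negP => leji; have ltjt : (j < t)%N by apply: leq_ltn_trans leji ltit.
have := @nth_find _ 0%N a (iota 0 t); rewrite has_find size_iota -/j => /(_ ltjt).
by rewrite nth_iota // /a leqNgt (leq_trans ltc (anti _ _ leji)).
Qed.

Section Tableau.
Variables (K : fieldType) (n t : nat) (alpha : t.*2.-tuple 'I_n).
Variable i0 : 'I_n.
Local Notation mono := 'X_{1..#|{: indet n}|}.
Implicit Type m : mono.

(** The number of entries below [x] in row [k] of the tableau, entries being counted from 0; [x = n]
    gives the length of the row. *)
Definition row_len m k x := rsk_shape (sym_mat m) k x n.

(* The entries of the row number k are at least alpha_k, and there is no row
   number 2t. *)
Definition standard m : bool :=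
  [forall k : 'I_(t.*2), row_len m k (tnth alpha k) == 0%N] &&
  (row_len m t.*2 n == 0%N).

(** The value [n], returned by an unsuccessful search, marks a missing box. *)
Definition tab_entry m k c : nat := find (fun u => c < row_len m k u.+1)%N (iota 0 n).

(** Rows [2u] and [2u + 1] have the same length, so half the length of column [c] is found on the
    even rows. Stopping at [t] loses nothing when [m] is standard. *)
Definition col_half m c : nat := find (fun u => row_len m u.*2 n <= c)%N (iota 0 t).

Definition col_tuple m c : (col_half m c).*2.-tuple 'I_n :=
  [tuple insubd i0 (tab_entry m k c) | k < (col_half m c).*2].

Definition tab_poly m : {mpoly K[#|{: indet n}|]} :=
  \prod_(c < row_len m 0 n) Pf K (col_tuple m c).

Lemma tab_entry_lt m k c x : (x <= n)%N -> (tab_entry m k c < x)%N = (c < row_len m k x)%N.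
Proof.
apply: (@find_mono_lt n (row_len m k)); last exact: rsk_shape0y.
by move=> u v leuv; apply: rsk_shape_mono.
Qed.

Lemma row_len_even m k : row_len m k.*2.+1 n = row_len m k.*2 n.
Proof. by apply: rsk_shape_even => [x y|x]; [apply: sym_mat_sym | apply: sym_mat_diag]. Qed.

Lemma col_half_lt m c k : (k < (col_half m c).*2)%N = (k < t.*2)%N && (c < row_len m k n)%N.
Proof.
rewrite -!ltn_half_double find_anti_lt; last first.
  by move=> u v leuv; apply: rsk_shape_anti; rewrite leq_double.
congr (_ && (_ < _)%N); rewrite -[k in RHS]odd_double_half.
by case: (odd k); rewrite ?add1n ?row_len_even.
Qed.

Lemma tab_entry_max m k c : (k < (col_half m c).*2)%N -> (tab_entry m k c < n)%N.
Proof. by rewrite col_half_lt tab_entry_lt // => /andP[]. Qed.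

Lemma tnth_col m c k : tnth (col_tuple m c) k = tab_entry m k c :> nat.
Proof. by rewrite tnth_mktuple val_insubd tab_entry_max. Qed.

Lemma col_increasing m c : increasing (col_tuple m c).
Proof.
apply/(sortedP 0%N) => k; rewrite size_map size_tuple => ltk.
have ltk' := ltnW ltk.
have nthE l (ltl : (l < (col_half m c).*2)%N) :
    nth 0%N (map val (col_tuple m c)) l = tab_entry m l c.
  by rewrite (nth_map i0) ?size_tuple // -(tnth_col (Ordinal ltl)) (tnth_nth i0).
rewrite !nthE //.
have lt1 := tab_entry_max ltk; change (tab_entry m k c < tab_entry m k.+1 c)%N.
rewrite tab_entry_lt; last exact: ltnW.
apply: leq_trans (rsk_shape_strict _ _ _ _).
by rewrite -/(row_len m k.+1 _) -tab_entry_lt.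
Qed.

Lemma col_half_le m c : ((col_half m c).*2 <= t.*2)%N.
Proof. by rewrite leq_double -[t in leqRHS](size_iota 0) find_size. Qed.

Lemma col_ge_alpha m c k : standard m ->
  (tnth alpha (widen_ord (col_half_le m c) k) <= tnth (col_tuple m c) k)%N.
Proof.
case/andP=> /forallP/(_ (widen_ord (col_half_le m c) k))/eqP row0 _.
rewrite tnth_col leqNgt tab_entry_lt /= ?row0 //.
by apply: ltnW; apply: ltn_ord.
Qed.

Lemma row_len_eq0 m k x : standard m -> (t.*2 <= k)%N -> (x <= n)%N -> row_len m k x = 0%N.
Proof.
case/andP=> _ /eqP row0 lek lex; apply/eqP; rewrite -leqn0 -row0.
apply: leq_trans (rsk_shape_anti _ _ _ lek); exact: rsk_shape_mono.
Qed.

Lemma sum_row_len m x k : (x <= n)%N ->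
  (\sum_(c < row_len m 0 n) (c < row_len m k x) = row_len m k x)%N.
Proof.
move=> lex; have le0 : (row_len m k x <= row_len m 0 n)%N.
  by apply: leq_trans (rsk_shape_anti _ _ _ (leq0n k)); apply: rsk_shape_mono.
rewrite -[RHS](minn_idPr le0); elim: (row_len m 0 n) => [|C IHC]; first by rewrite big_ord0 min0n.
by rewrite big_ord_recr /= IHC; lia.
Qed.

Lemma tab_poly_dhomog m : standard m -> tab_poly m \is (mdeg m).-homog.
Proof.
move=> std; suff -> : mdeg m = (\sum_(c < row_len m 0 n) col_half m c)%N.
  by apply: dhomog_bigprod => c _; apply/Pf_dhomog/col_increasing.
(* The tableau has [2 * mdeg m] letters. Row [2t] being empty, they all lie in the first [2t] rows,
   and they are counted again by columns. *)
apply: double_inj; rewrite -mul2n -sym_mat_sum -(@rsk_shape_sum _ t.*2) => [|u v ltu ltv]; last first.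
  have : rsk_shape (sym_mat m) t.*2 u.+1 v.+1 = 0%N.
    apply/eqP; rewrite -leqn0 -(row_len_eq0 std (leqnn _) (leqnn n)).
    exact: rsk_shape_mono.
  by rewrite /rsk_shape lppSS => /eqP; rewrite addn_eq0 => /andP[_ /eqP].
rewrite -[RHS]mul2n big_distrr /=.
rewrite (eq_bigr (fun k : 'I_(t.*2) => \sum_(c < row_len m 0 n) (c < row_len m k n))%N); last first.
  by move=> k _; rewrite sum_row_len.
rewrite exchange_big /=; apply: eq_bigr => c _.
rewrite mul2n -[RHS](minn_idPr (col_half_le m c)).
rewrite (eq_bigr (fun k : 'I_(t.*2) => (k < (col_half m c).*2)%N : nat)); last first.
  by move=> k _; rewrite col_half_lt ltn_ord.
elim: (t.*2) => [|C IHC]; first by rewrite big_ord0 min0n.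
by rewrite big_ord_recr /= IHC; lia.
Qed.

Lemma mlead_tab_poly m : standard m ->
  param alpha (tab_poly m) != 0 /\
  forall (k : 'I_(t.*2)) j, (mlead (param alpha (tab_poly m)) (y_index k j) =
    \sum_(c < row_len m 0 n) ((c < row_len m k n) && (tab_entry m k c == j)))%N.
Proof.
move=> std.
have leadP c := mlead_param_Pf K (col_increasing m c) (fun k => col_ge_alpha k std).
have E : param alpha (tab_poly m) = \prod_(c < row_len m 0 n) param alpha (Pf K (col_tuple m c)).
  exact: rmorph_prod.
rewrite E; split; first by apply/prodf_neq0 => c _; have [] := leadP c.
move=> k j; rewrite mlead_prod => [|c _ _]; last by have [] := leadP c.
rewrite mnm_sumE; apply: eq_bigr => c _; have [-> _] := leadP c.
have := col_half_lt m c k; rewrite ltn_ord /= => <-; rewrite y_monE.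
case: ltnP => [ltk | lek].
  rewrite (bigD1 (Ordinal ltk)) //= big1 => [|i ni].
    by rewrite addn0 -val_eqE eqxx /= -val_eqE /= tnth_col.
  by move: ni; rewrite -!val_eqE /= => /negPf ->.
apply: big1 => i _; rewrite -val_eqE /=; case: eqP => // ik.
by have := ltn_ord i; rewrite ltnNge ik lek.
Qed.

Lemma row_len_mlead m (k : 'I_(t.*2)) x : standard m -> (x <= n)%N ->
  (\sum_(j < n | (j < x)%N) mlead (param alpha (tab_poly m)) (y_index k j) = row_len m k x)%N.
Proof.
move=> std lex; have [_ leadE] := mlead_tab_poly std.
under eq_bigr do rewrite leadE; rewrite exchange_big /= -[RHS]sum_row_len //.
apply: eq_bigr => c _; rewrite -[(c < row_len m k x)%N]tab_entry_lt //.
have [ltc | gec] := ltnP c (row_len m k n); last first.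
  rewrite big1 // tab_entry_lt // ltnNge; apply/esym/eqP; rewrite eqb0 negbK.
  by apply: leq_trans gec; apply: rsk_shape_mono.
have lte : (tab_entry m k c < n)%N by rewrite tab_entry_lt.
rewrite big_mkcond (bigD1 (Ordinal lte)) //= eqxx big1 => [|j nj].
  by case: ifP.
by case: ifP => //; rewrite [_ == _]eq_sym (negPf nj : (j == tab_entry m k c :> nat) = false).
Qed.

(** The leading monomial records the content of each row, hence every [row_len], and these determine
    the symmetric matrix of exponents. *)
Lemma tab_poly_inj m m' : standard m -> standard m' ->
  mlead (param alpha (tab_poly m)) = mlead (param alpha (tab_poly m')) -> m = m'.
Proof.
move=> std std' eqlead; apply/mnmP => e.
rewrite -(enum_valK e) -!sym_mat_indet.
apply: (@rsk_shape_inj n) => //; try exact: sym_mat_sym.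
move=> k x lex; rewrite -/(row_len m k x) -/(row_len m' k x).
have [ltk | gek] := ltnP k t.*2; last by rewrite !row_len_eq0.
by rewrite -!(row_len_mlead (Ordinal ltk)) // eqlead.
Qed.

Lemma nonstandard_chain m : ~~ standard m -> exists p s,
  [/\ down_chain (p :: s), all (fun q => 0 < sym_mat m q.1 q.2)%N (p :: s) &
      (exists2 k : 'I_(t.*2), size s = k & (p.1 < tnth alpha k)%N) \/
      (size s = t.*2 /\ (p.1 < n)%N)].
Proof.
rewrite negb_and => /orP[/forallPn[k] | ]; rewrite -lt0n => /rsk_shape_chain[p [s [? ? ? ?]]].
  by exists p, s; split=> //; left; exists k.
by exists p, s; split=> //; right.
Qed.

End Tableau.

(** * Counting standard monomials *)

Section Counting.
Variables (K : fieldType) (n t : nat) (alpha : t.*2.-tuple 'I_n).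
Variable i0 : 'I_n.
Local Notation mono := 'X_{1..#|{: indet n}|}.
Variable le : rel mono.
Hypothesis hle : term_order le.
(** To be supplied by the generators: a nonstandard monomial is a multiple of the initial monomial
    of a Pfaffian killed by [param]. *)
Hypothesis reducible : forall m, ~~ standard alpha m -> exists h : {mpoly K[#|{: indet n}|]},
  [/\ param alpha h = 0, h \is (mdeg m).-homog & is_initial le h m].

Lemma independent_mlead N k (q : 'I_k -> {mpoly K[N]}) (v : 'I_k -> K) :
  (forall i, q i != 0) -> injective (fun i => mlead (q i)) ->
  \sum_i v i *: q i = 0 -> forall i, v i = 0.
Proof.
move=> nz injq sum0 i1; apply/eqP/negPn/negP => vi1.
have := @arg_maxP _ _ _ i1 (fun i => v i != 0) (fun i => mlead (q i)) vi1.
case=> i vi max_i.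
have := congr1 (mcoeff (mlead (q i))) sum0.
rewrite raddf_sum mcoeff0 (bigD1 i) //= big1 => [|j nj].
  by move/eqP; rewrite addr0 mcoeffZ mulf_eq0 (negPf vi) mleadc_eq0 (negPf (nz i)).
rewrite mcoeffZ; have [-> | vj] := eqVneq (v j) 0; first by rewrite mul0r.
rewrite mcoeff_gt_mlead ?mulr0 // lt_neqAle.
rewrite (max_i j vj : (mlead (q j) <= mlead (q i))%O) andbT.
by rewrite (inj_eq injq).
Qed.

(** Were [m0] standard, [f] would let it be eliminated along with the nonstandard monomials. The
    images of the other standard monomials [S] of degree [d] would then span, although there are
    [size G > size S] independent images of tableau polynomials. *)
Lemma homog_initial_standard (f : {mpoly K[#|{: indet n}|]}) m0 : param alpha f = 0 ->
  f \is (mdeg m0).-homog -> is_initial le f m0 -> ~~ standard alpha m0.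
Proof.
move=> f0 homf inif; apply/negP => std0.
set d := mdeg m0 in homf.
have [[lerefl leanti letrans letotal] _] := hle.
pose G : seq mono := map val (filter (fun u => (mdeg (val u) == d) && standard alpha (val u))
    (enum {: 'X_{1..#|{: indet n}| < d.+1}})).
pose S := [seq m <- G | m != m0].
have memG m : (m \in G) = (mdeg m == d) && standard alpha m.
  apply/mapP/idP => [[u] | /andP[dm sm]]; first by rewrite mem_filter => /andP[? _] ->.
  have ltm : (mdeg m < d.+1)%N by rewrite (eqP dm).
  by exists (BMultinom ltm) => //; rewrite mem_filter mem_enum /= dm sm.
have uniqG : uniq G by rewrite (map_inj_uniq val_inj) filter_uniq ?enum_uniq.
have ltSG : (size S < size G)%N.
  rewrite size_filter -(count_predC (pred1 m0) G) -[ltnLHS]add0n ltn_add2r.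
  by rewrite -has_count; apply/hasP; exists m0; rewrite /= ?memG /d ?eqxx.
pose span q := exists c : mono -> K, q = \sum_(u <- S) c u *: param alpha 'X_[u].
have spanZ x q : span q -> span (x *: q).
  case=> c ->; exists (fun u => x * c u); rewrite scaler_sumr.
  by apply: eq_bigr => u _; rewrite scalerA.
have spanD q1 q2 : span q1 -> span q2 -> span (q1 + q2).
  case=> c1 -> [c2 ->]; exists (fun u => c1 u + c2 u); rewrite -big_split.
  by apply: eq_bigr => u _; rewrite scalerDl.
have span0 : span 0.
  by exists (fun=> 0); rewrite big1 // => u _; rewrite scale0r.
have span_sum (s : seq mono) (P : pred mono) (F : mono -> {mpoly K[t.*2 * n]}) :
    (forall u, u \in s -> P u -> span (F u)) -> span (\sum_(u <- s | P u) F u).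
  move=> spanF; rewrite big_seq_cond; apply: (big_ind span) => // u /andP[us Pu].
  exact: spanF.
have spanX m : mdeg m = d -> span (param alpha 'X_[m]).
  (* The elimination terminates because only finitely many monomials of degree at most [d] lie below
     [m]; well-foundedness of [le] is not invoked. *)
  pose below m : {set 'X_{1..#|{: indet n}| < d.+1}} := [set u | le (val u) m & val u != m].
  have [r le_r] := ubnP #|below m|; elim: r m le_r => // r IHr m.
  rewrite ltnS => le_r dm; have [inS | ninS] := boolP (m \in S).
    exists (fun u => (u == m)%:R); rewrite (bigD1_seq m) ?filter_uniq //= eqxx scale1r.
    by rewrite big1 ?addr0 // => u /negPf ->; rewrite scale0r.
  have [h [h0 homh [hm hlt]]] : exists h : {mpoly K[#|{: indet n}|]},
      [/\ param alpha h = 0, h \is d.-homog & is_initial le h m].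
    have [-> | nm] := eqVneq m m0; first by exists f.
    rewrite -dm; apply: reducible; apply: contraNN ninS => sm.
    by rewrite mem_filter nm memG dm eqxx.
  rewrite mcoeff_msupp in hm.
  have E : param alpha 'X_[m] = - (h@_m)^-1 *:
      \sum_(u <- msupp h | u != m) h@_u *: param alpha 'X_[u].
    apply: (scalerI hm); rewrite scalerA mulrN divff // scaleN1r.
    apply/eqP; rewrite -addr_eq0; apply/eqP; rewrite -[RHS]h0 [in RHS](mpolyE h) rmorph_sum.
    rewrite (bigD1_seq m) ?msupp_uniq ?mcoeff_msupp //= paramZ; congr (_ + _).
    by apply: eq_bigr => u _; rewrite paramZ.
  rewrite E; apply/spanZ/span_sum => u uh num; apply: spanZ.
  have du : mdeg u = d by apply: (dhomog_mf homh).
  apply: IHr => //; apply: leq_trans le_r.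
  have ltu : (mdeg u < d.+1)%N by rewrite du.
  apply/proper_card/properP; split.
    apply/subsetP => w; rewrite !inE => /andP[lewu nwu].
    rewrite (letrans _ _ _ lewu (hlt u uh)) /=; apply: contraNneq nwu => wm.
    by apply/eqP/leanti/andP; split=> //; move: (hlt u uh); rewrite -wm.
  by exists (BMultinom ltu); rewrite !inE /= ?hlt ?num // eqxx andbF.
have spanT m : m \in G -> span (param alpha (tab_poly K t i0 m)).
  rewrite memG => /andP[/eqP dm sm]; rewrite [tab_poly _ _ _ _]mpolyE rmorph_sum.
  apply: span_sum => u uh _; rewrite /= paramZ; apply: spanZ.
  apply: spanX; rewrite -dm.
  have hom : tab_poly K t i0 m \is (mdeg m).-homog by apply: tab_poly_dhomog sm.
  exact: dhomog_mf hom u uh.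
pose Gi (i : 'I_(size G)) := nth m0 G i.
have GiP i : Gi i \in G by apply: mem_nth.
have [c cE] := fin_all_exists (fun i => spanT _ (GiP i)).
pose C : 'M[K]_(size G, size S) := \matrix_(i, j) c i (nth m0 S j).
(* The matrix expressing the tableau images in terms of [S] has more rows than columns, so its rows
   satisfy a nontrivial relation. *)
have : kermx C != 0.
  rewrite kermx_eq0 -row_leq_rank -ltnNge.
  exact: leq_ltn_trans (rank_leq_col C) ltSG.
case/rowV0Pn=> v /sub_kermxP vC /eqP[]; apply/rowP => i; rewrite mxE.
apply: (@independent_mlead _ _ (fun i => param alpha (tab_poly K t i0 (Gi i))) (v 0)).
- move=> j; have := GiP j; rewrite memG => /andP[_ sj].
  by have [] := mlead_tab_poly K i0 sj.
- move=> j l /= /tab_poly_inj eqjl; apply/val_inj/eqP.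
  rewrite -(nth_uniq m0 _ _ uniqG) ?ltn_ord //; apply/eqP; apply: eqjl.
    by have := GiP j; rewrite memG => /andP[].
  by have := GiP l; rewrite memG => /andP[].
under eq_bigr do rewrite cE (big_nth m0) big_mkord scaler_sumr.
rewrite exchange_big /=; apply: big1 => j _.
have := congr1 (fun w : 'rV_(size S) => w 0 j) vC; rewrite !mxE => vC0.
rewrite -[RHS](scale0r (param alpha 'X_[nth m0 S j])) -vC0 scaler_suml.
by apply: eq_bigr => l _; rewrite scalerA !mxE.
Qed.

(** The component of [f] in the degree of [m] is still in the kernel and still has initial monomial
    [m]. *)
Lemma initial_nonstandard (f : {mpoly K[#|{: indet n}|]}) m : param alpha f = 0 -> is_initial le f m ->
  ~~ standard alpha m.
Proof.
move=> f0 [mf maxm]; apply: (@homog_initial_standard (pihomog mdeg (mdeg m) f)).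
- exact: param_pihomog.
- exact: pihomogP.
have coefE u : (pihomog mdeg (mdeg m) f)@_u = if mdeg u == mdeg m then f@_u else 0.
  rewrite pihomogE raddf_sum /=.
  under eq_bigr do rewrite mcoeffZ mcoeffX.
  have [uf | nuf] := boolP (u \in msupp f); last first.
    rewrite (memN_msupp_eq0 nuf) if_same big_seq_cond big1 // => w /andP[wf _].
    by case: eqP wf nuf => [-> -> // | _ _ _]; rewrite mulr0.
  rewrite big_mkcond (bigD1_seq u) ?msupp_uniq //= eqxx mulr1 big1 ?addr0 //.
  by move=> w /negPf nwu; rewrite nwu mulr0 if_same.
split=> [|u]; first by rewrite mcoeff_msupp coefE eqxx -mcoeff_msupp.
rewrite mcoeff_msupp coefE; case: (_ == mdeg m); last by rewrite eqxx.
by rewrite -mcoeff_msupp; apply: maxm.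
Qed.

End Counting.

(** * Anti-diagonals as nested sequences of indeterminates *)

Section Nested.
Variable n : nat.
Implicit Types (p q : indet n) (l : seq (indet n)) (m : 'X_{1..#|{: indet n}|}).

(** An anti-diagonal is handled as the list of its indeterminates from the outermost inwards.
    Sublists are again anti-diagonals, and divisibility becomes inclusion. *)
Definition nest p q : bool :=
  ((val p).1 < (val q).1)%N && ((val q).2 < (val p).2)%N.

Definition mon_seq l : 'X_{1..#|{: indet n}|} := (\sum_(p <- l) mon_of p)%MM.

Lemma nest_trans : transitive nest.
Proof. by move=> p q r; rewrite /nest => /andP[? ?] /andP[? ?]; lia. Qed.

Lemma nest_uniq l : sorted nest l -> uniq l.
Proof. by apply: (sorted_uniq nest_trans) => p; rewrite /nest ltnn. Qed.

Lemma nest_row_col l p q : sorted nest l -> p \in l -> q \in l ->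
  ((val p).1 < (val q).2)%N.
Proof.
move=> srt pl ql.
have [-> | npq] := eqVneq p q; first exact: (valP q).
have ltp : ((val p).1 < (val p).2)%N := valP p.
have ltq : ((val q).1 < (val q).2)%N := valP q.
have: nest p q || nest q p; last by rewrite /nest; lia.
have ip : (index p l < size l)%N by rewrite index_mem.
have iq : (index q l < size l)%N by rewrite index_mem.
have := sorted_ltn_nth nest_trans p srt.
case: (ltngtP (index p l) (index q l)) => [lt | gt | eqi] H.
- by have := H _ _ ip iq lt; rewrite !nth_index // => ->.
- by have := H _ _ iq ip gt; rewrite !nth_index // => ->; rewrite orbT.
by case/eqP: npq; rewrite -(nth_index p pl) -(nth_index p ql) eqi.
Qed.

Lemma mon_seqE l p : mon_seq l (enum_rank p) = count_mem p l.
Proof.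
rewrite mnm_sumE -sumn_count sumnE big_map; apply: eq_bigr => q _.
by rewrite mnm1E (inj_eq enum_rank_inj).
Qed.

Lemma mon_seq_uniq l p : uniq l -> mon_seq l (enum_rank p) = (p \in l).
Proof. by move=> ul; rewrite mon_seqE count_uniq_mem. Qed.

Lemma indets_mon_seq l : indets (mon_seq l) = [set p in l].
Proof. by apply/setP => p; rewrite !inE mon_seqE -has_count has_pred1. Qed.

Lemma card_indets_mon_seq l (A : {set indet n}) : uniq l ->
  #|indets (mon_seq l) :&: A| = count (mem A) l.
Proof.
move=> ul; rewrite indets_mon_seq -size_filter -(card_uniqP (filter_uniq _ ul)).
by apply: eq_card => p; rewrite !inE mem_filter andbC.
Qed.

Lemma mon_seq_le l m : uniq l -> {in l, forall p, 0 < m (enum_rank p)}%N ->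
  (mon_seq l <= m)%MM.
Proof.
move=> ul pos; apply/mnm_lepP => e; rewrite -(enum_valK e) mon_seq_uniq //.
by case: (boolP (_ \in l)) => // /pos.
Qed.

Lemma mon_seq_sub l1 l2 : (mon_seq l1 <= mon_seq l2)%MM -> {subset l1 <= l2}.
Proof.
move=> /mnm_lepP le12 p; rewrite -has_pred1 has_count -mon_seqE => pos.
by rewrite -has_pred1 has_count -mon_seqE (leq_trans pos).
Qed.

Lemma pair_adiag_subproof s (c : s.*2.-tuple 'I_n) (k : 'I_s) :
  increasing c -> (tnth c (ord_lo k) < tnth c (rev_ord (ord_lo k)))%N.
Proof. by move=> inc; apply: tnth_increasing => //=; have := ltn_ord k; lia. Qed.

Lemma adiag_monP s (c : s.*2.-tuple 'I_n) : increasing c ->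
  exists l, [/\ sorted nest l, size l = s, adiag_mon c = mon_seq l &
    forall k : 'I_s, exists2 p, p \in l &
      val p = (tnth c (ord_lo k), tnth c (rev_ord (ord_lo k)))].
Proof.
move=> inc.
pose P k : indet n := exist _ (tnth c (ord_lo k), tnth c (rev_ord (ord_lo k)))
  (pair_adiag_subproof k inc).
exists [seq P k | k <- enum 'I_s]; split.
- rewrite sorted_map; apply: (@sub_sorted _ (relpre val ltn)); last first.
    by rewrite -sorted_map val_enum_ord iota_ltn_sorted.
  move=> k l /= ltkl; rewrite /nest /=; apply/andP; split.
    exact: tnth_increasing.
  by apply: tnth_increasing => //=; have := ltn_ord l; lia.
- by rewrite size_map size_enum_ord.
- rewrite /mon_seq big_map big_enum /=; apply: eq_bigr => k _.
  exact: (Xmon_indet (P k)).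
by move=> k; exists (P k) => //; rewrite map_f ?mem_enum.
Qed.

Lemma nested_adiag l : sorted nest l -> (0 < size l)%N ->
  is_adiag (size l) (mon_seq l).
Proof.
move=> srt pos.
pose s := [seq (val p).1 | p <- l] ++ rev [seq (val p).2 | p <- l].
have szs : size s == (size l).*2 by rewrite size_cat size_rev !size_map addnn.
exists (Tuple szs); split=> //.
  rewrite /increasing /= /s map_cat map_rev -!map_comp sorted_pairwise; last exact: ltn_trans.
  rewrite pairwise_cat -!sorted_pairwise ?rev_sorted ?sorted_map; try exact: ltn_trans.
    apply/and3P; split.
    - apply/allrelP => x y /mapP[p pl ->]; rewrite mem_rev => /mapP[q ql ->] /=.
      exact: nest_row_col srt pl ql.
    - by apply: sub_sorted srt => p q /andP[].
    - by apply: sub_sorted srt => p q /andP[].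
have [p0 _] : exists p0, p0 \in l by case: (l) pos => // p l' _; exists p; rewrite mem_head.
rewrite /mon_seq (big_nth p0) big_mkord; apply: eq_bigr => k _.
have ltk := ltn_ord k.
rewrite !(tnth_nth (val p0).1) /= /s !nth_cat !size_map ltk.
have -> : ((size l).*2 - k.+1 < size l)%N = false by lia.
rewrite (nth_map p0) // nth_rev size_map; last by lia.
rewrite (_ : (_ - _ = k)%N); last by lia.
by rewrite (nth_map p0) // Xmon_indet.
Qed.

(** * Generators dividing a nonstandard monomial *)

Variables (t a b : nat).
Hypotheses (t_ge2 : (2 <= t)%N) (a_ge2 : (2 <= a)%N).
Local Notation A := (regA n a).
Local Notation B := (regB n a b).
Local Notation C := (regC n a b).
Local Notation D := (regD n a b).
Local Notation in_supp m l := {in l, forall p : indet n, 0 < m (enum_rank p)}%N.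

Definition has_gen m := exists2 g, gens t a b g & (g <= m)%MM.

Lemma has_gen_i m p : p \in A -> (0 < m (enum_rank p))%N -> has_gen m.
Proof.
move=> pA mp; exists (mon_of p); first by constructor 1; exists p.
have := @mon_seq_le [:: p] m isT; rewrite /mon_seq big_seq1; apply.
by move=> q; rewrite inE => /eqP ->.
Qed.

Lemma gens_ii_le m l : sorted nest l -> in_supp m l ->
  (1 < count (mem (B :|: C)) l)%N -> exists2 g, gens_ii a b g & (g <= m)%MM.
Proof.
move=> srt supp; rewrite -size_filter => sz.
set l' := take 2 (filter (mem (B :|: C)) l).
have srt' : sorted nest l' by apply/take_sorted/(sorted_filter nest_trans).
have sz' : size l' = 2%N by rewrite size_takel.
have sub p : p \in l' -> (p \in B :|: C) && (p \in l).
  by move/mem_take; rewrite mem_filter.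
exists (mon_seq l'); last first.
  by apply: mon_seq_le (nest_uniq srt') _ => p /sub/andP[_ /supp].
split; first by rewrite -sz'; apply: nested_adiag; rewrite ?sz'.
by rewrite indets_mon_seq; apply/subsetP => p; rewrite inE => /sub/andP[].
Qed.

Lemma has_gen_ii m l : sorted nest l -> in_supp m l ->
  (1 < count (mem (B :|: C)) l)%N -> has_gen m.
Proof.
by move=> srt supp /(gens_ii_le srt supp)[g gii le_gm]; exists g => //; constructor 2.
Qed.

(** After truncation to [t] members, one in [A] or two in the union of [B] and [C] already give a
    generator. Otherwise the bound on the columns leaves only [B] and [D], with at most one member
    in [B]. *)
Lemma has_gen_iii m l : sorted nest l -> in_supp m l -> (t <= size l)%N ->
  {in l, forall p, col_no p <= b - 1}%N -> has_gen m.
Proof.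
move=> srt supp sz colb; set l' := take t l.
have srt' : sorted nest l' by apply: take_sorted.
have sz' : size l' = t by rewrite size_takel.
have supp' : in_supp m l' by move=> p /mem_take/supp.
have [/hasP[p pl pA] | /hasPn nA] := boolP (has (mem A) l').
  by apply: has_gen_i pA (supp' p pl).
have [gt1 | le1] := ltnP 1 (count (mem (B :|: C)) l'); first exact: has_gen_ii gt1.
exists (mon_seq l'); last exact: mon_seq_le (nest_uniq srt') supp'.
constructor 3; split.
- by rewrite -sz'; apply: nested_adiag; rewrite ?sz' //; lia.
- rewrite indets_mon_seq; apply/subsetP => p; rewrite inE => pl.
  have := nA p pl; have := colb p (mem_take pl); rewrite !inE; lia.
rewrite card_indets_mon_seq ?nest_uniq //; apply: leq_trans le1.
by apply: sub_count => p /=; rewrite !inE => ->.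
Qed.

(** Types (i) and (ii) are excluded in the same way. If [t] members lie in the union of [B] and [D],
    they fall under [has_gen_iii]; if not, all the conditions of type (iv) hold. *)
Lemma has_gen_iv m l : sorted nest l -> in_supp m l -> (t < size l)%N -> has_gen m.
Proof.
move=> srt0 supp0 sz0; set l' := take t.+1 l.
have srt : sorted nest l' by apply: take_sorted.
have sz : size l' = t.+1 by rewrite size_takel.
have supp : in_supp m l' by move=> p /mem_take/supp0.
have [/hasP[p pl pA] | /hasPn nA] := boolP (has (mem A) l').
  by apply: has_gen_i pA (supp p pl).
have [gt1 | le1] := ltnP 1 (count (mem (B :|: C)) l'); first exact: has_gen_ii gt1.
have [get | ltt] := leqP t (count (mem (B :|: D)) l').
  apply: (@has_gen_iii m (filter (mem (B :|: D)) l')); rewrite ?size_filter //.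
  - exact: (sorted_filter nest_trans _ srt).
  - by move=> p; rewrite mem_filter => /andP[_ /supp].
  - by move=> p; rewrite mem_filter => /andP[]; rewrite !inE; lia.
exists (mon_seq l'); last exact: mon_seq_le (nest_uniq srt) supp.
constructor 4; split.
- by rewrite -sz; apply: nested_adiag; rewrite ?sz.
- rewrite indets_mon_seq disjoint_subset; apply/subsetP => p; rewrite inE => pl.
  exact: nA.
- rewrite card_indets_mon_seq ?nest_uniq //; apply: leq_trans le1.
  by apply: sub_count => p /=; rewrite !inE => ->.
by rewrite card_indets_mon_seq ?nest_uniq //; lia.
Qed.

Lemma lift_lower m (s : seq (nat * nat)) :
  all (fun u => (0 < sym_mat m u.1 u.2)%N && (u.2 < u.1)%N) s ->
  exists2 l, s = [seq ((val p).2 : nat, (val p).1 : nat) | p <- l] & in_supp m l.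
Proof.
elim: s => [_ | [x y] s IHs /= /andP[/andP[/sym_mat_gt0[p mp xy] ltyx] /IHs[l -> supp]]].
  by exists [::].
exists (p :: l); last by move=> q; rewrite inE => /orP[/eqP -> | /supp].
have ltp : ((val p).1 < (val p).2)%N := valP p.
by case: xy => -[<- <-] // in ltyx *; move: ltyx; rewrite ltnNge ltnW.
Qed.

Lemma lift_upper m (s : seq (nat * nat)) :
  all (fun u => (0 < sym_mat m u.1 u.2)%N && (u.1 < u.2)%N) s ->
  exists2 l, s = [seq ((val p).1 : nat, (val p).2 : nat) | p <- l] & in_supp m l.
Proof.
move=> sup; have [|l sE supp] := @lift_lower m [seq (u.2, u.1) | u <- s].
  by rewrite all_map; apply: sub_all sup => q /=; rewrite sym_mat_sym.
exists l => //; have := congr1 (map (fun u => (u.2, u.1))) sE; rewrite -!map_comp => <-.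
by rewrite (eq_map (g := id)) ?map_id // => -[x y].
Qed.

Local Notation chain_in m s :=
  (down_chain s && all (fun u => 0 < sym_mat m u.1 u.2)%N s).

Lemma down_trans : transitive (fun u v : nat * nat => (v.1 < u.1) && (u.2 < v.2))%N.
Proof. by move=> u v w /andP[? ?] /andP[? ?]; lia. Qed.

Lemma down_chain_drop (p0 u : nat * nat) s0 i : down_chain (p0 :: s0) ->
  u \in drop i (p0 :: s0) -> (u.1 + i <= p0.1)%N.
Proof.
elim: i p0 s0 => [|i IHi] p0 s0 ch.
  rewrite drop0 addn0 inE => /orP[/eqP -> // | us].
  have := order_path_min down_trans (ch : path _ p0 s0).
  by move/allP/(_ u us)/andP => [/ltnW].
case: s0 ch => // r s0 /andP[/andP[ltr _] ch] /(IHi _ _ ch) leu.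
lia.
Qed.

(** Below the diagonal a point [(x, y)] stands for the indeterminate with row [y] and column [x], so
    a chain runs from the outside inwards. Above the diagonal it runs outwards, whence the [rev] in
    [chain_upper]. *)
Lemma chain_lower m s : chain_in m s ->
  exists l, [/\ sorted nest l, in_supp m l, size l = count (fun u => u.2 < u.1)%N s &
    {in l, forall p, exists2 u, u \in s & u.1 = (val p).2}].
Proof.
case/andP=> ch pos; have [|l sE supp] := @lift_lower m (filter (fun u => u.2 < u.1)%N s).
  apply/allP => u; rewrite mem_filter => /andP[-> us].
  by rewrite (allP pos).
exists l; split=> //.
- have := sorted_filter down_trans (fun u => u.2 < u.1)%N ch.
  by rewrite sE sorted_map; apply: sub_sorted => p q /andP[? ?]; apply/andP; split.
- by rewrite -size_filter sE size_map.
move=> p pl; exists ((val p).2 : nat, (val p).1 : nat) => //.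
suff: ((val p).2 : nat, (val p).1 : nat) \in filter (fun u => u.2 < u.1)%N s.
  by rewrite mem_filter => /andP[].
by rewrite sE; apply/mapP; exists p.
Qed.

Lemma chain_upper m s : chain_in m s ->
  exists l, [/\ sorted nest l, in_supp m l, size l = count (fun u => u.1 < u.2)%N s &
    {in l, forall p, exists2 u, u \in s & u.1 = (val p).1}].
Proof.
case/andP=> ch pos; have [|l sE supp] := @lift_upper m (filter (fun u => u.1 < u.2)%N s).
  apply/allP => u; rewrite mem_filter => /andP[-> us].
  by rewrite (allP pos).
exists (rev l); split=> //.
- rewrite rev_sorted; have := sorted_filter down_trans (fun u => u.1 < u.2)%N ch.
  by rewrite sE sorted_map; apply: sub_sorted => p q /andP[? ?]; apply/andP; split.
- by move=> p; rewrite mem_rev; apply: supp.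
- by rewrite size_rev -size_filter sE size_map.
move=> p; rewrite mem_rev => pl; exists ((val p).1 : nat, (val p).2 : nat) => //.
suff: ((val p).1 : nat, (val p).2 : nat) \in filter (fun u => u.1 < u.2)%N s.
  by rewrite mem_filter => /andP[].
by rewrite sE; apply/mapP; exists p.
Qed.

Lemma chain_count m s : chain_in m s ->
  (count (fun u => u.2 < u.1) s + count (fun u => u.1 < u.2) s = size s)%N.
Proof.
case/andP=> _ /allP pos; rewrite -[RHS](count_predC (fun u => u.2 < u.1)%N).
congr (_ + _)%N; apply: eq_in_count => -[x y] /pos /=.
by case: (ltngtP x y) => // ->; rewrite sym_mat_diag.
Qed.

Lemma chain_has_gen m s : chain_in m s -> (t.*2 < size s)%N -> has_gen m.
Proof.
move=> ch; rewrite -(chain_count ch) => sz.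
have [l1 [srt1 supp1 sz1 _]] := chain_lower ch.
have [l2 [srt2 supp2 sz2 _]] := chain_upper ch.
have [lt1 | le1] := ltnP t (size l1); first exact: has_gen_iv lt1.
have [lt2 | le2] := ltnP t (size l2); first exact: has_gen_iv lt2.
lia.
Qed.

(** The bound concerns the columns of the lower half only. That half has [t] points, giving type
    (iii), or else the upper half has more than [t]. *)
Lemma chain_has_gen_cols m s : chain_in m s -> (t.*2 <= size s)%N ->
  {in s, forall u, u.1 < b - 1}%N -> has_gen m.
Proof.
move=> ch; rewrite -(chain_count ch) => sz lt_b.
have [l1 [srt1 supp1 sz1 col1]] := chain_lower ch.
have [l2 [srt2 supp2 sz2 _]] := chain_upper ch.
have [le1 | lt1] := leqP t (size l1).
  apply: has_gen_iii srt1 supp1 le1 _ => p /col1[u us up].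
  by rewrite /col_no -up lt_b.
have [lt2 | le2] := ltnP t (size l2); first exact: has_gen_iv lt2.
lia.
Qed.

(** A point below the diagonal would have its column in range of [A]. If there is none, the bound is
    on the rows, and outside [A] this means [B] or [C]. *)
Lemma chain_has_gen_rows m s : chain_in m s -> (2 <= size s)%N ->
  {in s, forall u, u.1 < a - 1}%N -> has_gen m.
Proof.
move=> ch; rewrite -(chain_count ch) => sz lt_a.
have [l1 [srt1 supp1 sz1 col1]] := chain_lower ch.
have [l2 [srt2 supp2 sz2 row2]] := chain_upper ch.
case: l1 => [|p l1] in srt1 supp1 sz1 col1 *; last first.
  have pl : p \in p :: l1 by rewrite mem_head.
  apply: (@has_gen_i m p); last exact: supp1.
  by have [u us up] := col1 p pl; rewrite inE /col_no -up lt_a.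
have [/hasP[p pl pA] | /hasPn nA] := boolP (has (mem A) l2).
  by apply: has_gen_i pA (supp2 p pl).
apply: has_gen_ii srt2 supp2 _.
have -> : count (mem (B :|: C)) l2 = size l2; last by rewrite sz2 -sz1 in sz *.
apply/eqP; rewrite -all_count; apply/allP => p pl.
have [u us up] := row2 p pl; have := nA p pl; have := lt_a u us.
by rewrite !inE up /row_no /col_no; lia.
Qed.

Section Alpha.
Variable alpha : t.*2.-tuple 'I_n.
Hypothesis halpha :
  [seq (val i).+1 | i <- alpha] = (1 :: rcons (iota a (2 * t - 2)) b)%N.

Lemma alphaE (k : 'I_(t.*2)) :
  (tnth alpha k).+1 = nth 0%N (1 :: rcons (iota a (2 * t - 2)) b)%N k.
Proof.
rewrite -halpha {1}(tnth_nth (tnth alpha k)).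
rewrite (nth_map (tnth alpha k)) ?size_tuple //.
Qed.

Lemma alphaE_mid (k : 'I_(t.*2)) : (0 < k < (t.*2).-1)%N -> (tnth alpha k).+1 = (a + k.-1)%N.
Proof.
rewrite alphaE; case: (val k) => // j /= ltj.
by rewrite nth_rcons size_iota ifT ?nth_iota //; lia.
Qed.

Lemma alphaE_last (k : 'I_(t.*2)) : k = (t.*2).-1 :> nat -> (tnth alpha k).+1 = b.
Proof.
rewrite alphaE => ->; rewrite (_ : (t.*2).-1 = (2 * t - 2).+1); last by lia.
by rewrite /= nth_rcons size_iota ltnn eqxx.
Qed.

Lemma alpha_increasing : (a + 2 * t - 3 < b)%N -> increasing alpha.
Proof.
move=> hab.
apply/(sortedP 0%N) => k; rewrite size_map size_tuple => ltk.
have ltk' := ltnW ltk.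
have nthE i (ltl : (i < t.*2)%N) : nth 0%N (map val alpha) i = tnth alpha (Ordinal ltl).
  by rewrite (tnth_nth (tnth alpha (Ordinal ltl))) (nth_map (tnth alpha (Ordinal ltl))) ?size_tuple.
rewrite !nthE; change (tnth alpha (Ordinal ltk') < tnth alpha (Ordinal ltk))%N.
have := alphaE (Ordinal ltk'); have := @alphaE_mid (Ordinal ltk').
have := @alphaE_mid (Ordinal ltk); have := @alphaE_last (Ordinal ltk).
by move=> /=; case: k ltk ltk' => [|k] ltk ltk' /=; lia.
Qed.

Lemma nonstandard_has_gen m : ~~ standard alpha m -> has_gen m.
Proof.
case/nonstandard_chain=> p [s [ch pos alt]].
have chs : chain_in m (p :: s) by rewrite ch pos.
case: alt => [[k szs ltp] | [szs _]]; last first.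
  by apply: chain_has_gen chs _; rewrite /= szs.
have ltk := ltn_ord k.
have [k0 | kpos] := posnP k.
  by have := alphaE k; rewrite k0 /=; lia.
have [klast | kmid] := eqVneq (k : nat) (t.*2).-1.
  apply: chain_has_gen_cols chs _ _ => [|u us]; first by rewrite /= szs; lia.
  have := @down_chain_drop p u s 0 ch; rewrite drop0 addn0 => /(_ us) leu.
  by have := alphaE_last klast => eb; apply: leq_ltn_trans leu _; lia.
have kbound : (0 < k < (t.*2).-1)%N by lia.
(* Counted from 0, alpha_k is [a + k - 2]. The [k + 1] points have strictly decreasing first
   coordinates, so without the first [k - 1] of them two remain, both below [a - 1]. *)
apply: (@chain_has_gen_rows m (drop k.-1 (p :: s))).
- apply/andP; split; first exact: drop_sorted.
  by apply/allP => u /mem_drop us; apply: (allP pos).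
- by rewrite size_drop /= szs; lia.
move=> u /(down_chain_drop ch) leu; have := alphaE_mid kbound => ea.
have lta : (p.1 < a - 1 + k.-1)%N by lia.
by rewrite -(ltn_add2r k.-1); apply: leq_ltn_trans leu lta.
Qed.

End Alpha.
End Nested.

(** * Ideals *)

Section Ideals.
Variable R : comNzRingType.
Implicit Types S T : R -> Prop.

Lemma ideal_gen0 S : ideal_gen S 0.
Proof. by exists 0%N, (fun=> 0), (fun=> 0); split=> [[] // |]; rewrite big_ord0. Qed.

Lemma ideal_gen_cons S c g f : S g -> ideal_gen S f -> ideal_gen S (c * g + f).
Proof.
move=> Sg [k [c' [g' [Sg' ->]]]].
exists k.+1, (fun i => oapp c' c (unlift ord0 i)), (fun i => oapp g' g (unlift ord0 i)).
split=> [i|]; first by case: unliftP => [j _ | _]; [apply: Sg' | apply: Sg].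
by rewrite big_ord_recl unlift_none /=; congr (_ + _); apply: eq_bigr => i _; rewrite liftK.
Qed.

Lemma ideal_genM S c g : S g -> ideal_gen S (c * g).
Proof. by move=> Sg; rewrite -[_ * _]addr0; apply/ideal_gen_cons/ideal_gen0. Qed.

Lemma sub_ideal_gen S T f : (forall g, S g -> exists c h, T h /\ g = c * h) ->
  ideal_gen S f -> ideal_gen T f.
Proof.
move=> ST [k [c [g [Sg ->]]]]; elim: k c g Sg => [|k IHk] c g Sg.
  by rewrite big_ord0; apply: ideal_gen0.
rewrite big_ord_recl; have [d [h [Th ->]]] := ST _ (Sg ord0).
by rewrite mulrA; apply: ideal_gen_cons => //; apply: (IHk (fun i => c _)) => i.
Qed.

End Ideals.

Lemma mpolyX_ideal (K : fieldType) N (H : 'X_{1..N} -> Prop) m :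
  ideal_gen (fun g : {mpoly K[N]} => exists2 u, H u & g = 'X_[u]) 'X_[m] ->
  exists2 u, H u & (u <= m)%MM.
Proof.
case=> k [c [g [Hg eqX]]].
have: \sum_i (c i * g i)@_m != 0.
  by rewrite -raddf_sum -eqX /= mcoeffX eqxx oner_neq0.
case: (pickP (fun i => (c i * g i)@_m != 0)) => [i nz _ | none]; last first.
  by rewrite big1 ?eqxx // => i _; apply/eqP/negbFE/none.
have [u Hu gu] := Hg i; exists u => //; move: nz; rewrite gu -mcoeff_msupp.
case/msuppM_le/allpairsP=> -[m1 m2] /= [_ /mem_msuppXP <- ->].
exact: lem_addl.
Qed.

Lemma is_initial_mulX (K : fieldType) N (le : rel 'X_{1..N}) (f : {mpoly K[N]}) m u :
  term_order le -> is_initial le f m -> is_initial le ('X_[u] * f) (u + m)%MM.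
Proof.
case=> _ [_ leD] [mf maxm]; split.
  by rewrite mcoeff_msupp mulrC mcoeffMX -mcoeff_msupp.
move=> v /msuppM_le/allpairsP[[m1 m2] /= [/mem_msuppXP <- /maxm le2 ->]].
by rewrite ![(u + _)%MM]addmC; apply: leD.
Qed.

(** * The listed monomials as initial monomials, and their divisibility relations *)

Section Generators.
Variables (n t a b : nat).
Hypotheses (t_ge2 : (2 <= t)%N) (a_ge2 : (2 <= a)%N) (hab : (a + 2 * t - 3 < b)%N).
Variable alpha : t.*2.-tuple 'I_n.
Hypothesis halpha :
  [seq (val i).+1 | i <- alpha] = (1 :: rcons (iota a (2 * t - 2)) b)%N.
Implicit Types (l : seq (indet n)) (m g : 'X_{1..#|{: indet n}|}).
Local Notation A := (regA n a).
Local Notation B := (regB n a b).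
Local Notation C := (regC n a b).
Local Notation D := (regD n a b).

Lemma not_pf_le s (c : s.*2.-tuple 'I_n) (i : 'I_(s.*2)) (j : 'I_(t.*2)) :
  i = j :> nat -> (tnth c i < tnth alpha j)%N -> ~~ pf_le alpha c.
Proof.
move=> eqij lt; apply/pf_leP => -[le_st /(_ i)].
have -> : widen_ord le_st i = j by apply: val_inj.
by move=> le_ac; move: lt; rewrite ltnNge le_ac.
Qed.

(** The comparison with alpha fails at the second index, which is below [a], for types (i) and (ii);
    at the last index, which is below [b], for type (iii); and by size for type (iv). *)
Lemma gens_Pf g : gens t a b g -> exists s (c : s.*2.-tuple 'I_n),
  [/\ in_PX c, ~~ pf_le alpha c & g = adiag_mon c].
Proof.
have adP s (c : s.*2.-tuple 'I_n) (k : 'I_s) : increasing c ->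
    exists2 p, p \in indets (adiag_mon c) &
      val p = (tnth c (ord_lo k), tnth c (rev_ord (ord_lo k))).
  move=> inc; have [l [srt _ -> /(_ k)[p pl vp]]] := adiag_monP inc.
  by exists p => //; rewrite indets_mon_seq inE.
have lt1 : (1 < t.*2)%N by lia.
have ltt : ((t.*2).-1 < t.*2)%N by lia.
have a1 : (tnth alpha (Ordinal lt1)).+1 = a by rewrite (alphaE_mid t_ge2 a_ge2 halpha) /=; lia.
have at_ : (tnth alpha (Ordinal ltt)).+1 = b by rewrite (alphaE_last t_ge2 a_ge2 halpha).
case=> [[p pA ->] | [[c [_ inc ->]] sub] | [[c [pos inc ->]] sub _] | [[c [pos inc ->]] _ _ _]].
- have [c [_ inc eqm]] : is_adiag 1 (mon_of p).
    by have := @nested_adiag n [:: p] isT isT; rewrite /mon_seq big_seq1.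
  exists 1%N, c; split=> //; try by apply/andP; split.
  have [q] := adP _ c ord0 inc; rewrite -eqm => qp vq.
  have {qp} qp : q = p.
    move: qp; rewrite inE mnm1E lt0b => /eqP/enum_rank_inj -> //.
  apply: (@not_pf_le _ _ (rev_ord (ord_lo ord0)) (Ordinal lt1)) => //.
  have -> : tnth c (rev_ord (ord_lo ord0)) = (val p).2 by rewrite -qp vq.
  by move: pA; rewrite inE /col_no; lia.
- exists 2%N, c; split=> //; try by apply/andP; split.
  have [q qc vq] := adP _ c (Ordinal (isT : 1 < 2)%N) inc.
  apply: (@not_pf_le _ _ (ord_lo (Ordinal (isT : 1 < 2)%N)) (Ordinal lt1)) => //.
  have -> : tnth c (ord_lo (Ordinal (isT : 1 < 2)%N)) = (val q).1 by rewrite vq.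
  have lta : (row_no q < a)%N by move/subsetP/(_ q qc): sub; rewrite !inE; lia.
  by rewrite -ltnS a1; apply: lta.
- exists t, c; split=> //; try by apply/andP; split.
  have [q qc vq] := adP _ c (Ordinal pos) inc.
  apply: (@not_pf_le _ _ (rev_ord (ord_lo (Ordinal pos))) (Ordinal ltt)).
    by rewrite /= subn1.
  have -> : tnth c (rev_ord (ord_lo (Ordinal pos))) = (val q).2 by rewrite vq.
  have ltb : (col_no q < b)%N by move/subsetP/(_ q qc): sub; rewrite !inE; lia.
  by rewrite -ltnS at_; apply: ltb.
exists t.+1, c; split=> //; try by apply/andP; split.
by rewrite /pf_le ltnn.
Qed.

Lemma min_gens_gens g : min_gens t a b g -> gens t a b g.
Proof.
case=> [? | ? | ? | [? _]]; first by constructor 1.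
- by constructor 2.
- by constructor 3.
by constructor 4.
Qed.

Lemma gens_min_gens g : gens t a b g -> exists2 g', min_gens t a b g' & (g' <= g)%MM.
Proof.
case=> [gi | gii | giii | giv].
- by exists g; [constructor 1 | apply: lepm_refl].
- by exists g; [constructor 2 | apply: lepm_refl].
- by exists g; [constructor 3 | apply: lepm_refl].
have [le1 | gt1] := leqP #|indets g :&: (B :|: C)| 1.
  by exists g; [constructor 4 | apply: lepm_refl].
have [[c [_ inc gc]] _ _ _] := giv.
have [l [srt _ gl _]] := adiag_monP inc; rewrite -gc in gl; rewrite gl in gt1 *.
have ul := nest_uniq srt.
have supp : {in l, forall p, 0 < mon_seq l (enum_rank p)}%N.
  by move=> p pl; rewrite mon_seq_uniq ?pl.
rewrite card_indets_mon_seq // in gt1.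
by have [g' gii le_g] := gens_ii_le srt supp gt1; exists g' => //; constructor 2.
Qed.

Definition min_gen_shape l : Prop :=
  [\/ size l = 1%N /\ {subset l <= A},
      size l = 2%N /\ {subset l <= B :|: C},
      [/\ size l = t, {subset l <= B :|: D} & (count (mem B) l <= 1)%N] |
      [/\ size l = t.+1, {in l, forall p, p \notin A},
          (count (mem (B :|: D)) l <= t - 1)%N & (count (mem (B :|: C)) l <= 1)%N]].

Lemma min_gens_shape g : min_gens t a b g ->
  exists l, [/\ sorted (@nest n) l, g = mon_seq l & min_gen_shape l].
Proof.
have adP s m : is_adiag s m -> exists l, [/\ sorted (@nest n) l, size l = s & m = mon_seq l].
  case=> c [_ inc ->]; have [l [srt sz -> _]] := adiag_monP inc.
  by exists l.
have subP l (E : {set indet n}) : indets (mon_seq l) \subset E -> {subset l <= E}.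
  by move/subsetP=> sub p pl; apply: sub; rewrite indets_mon_seq inE.
case=> [[p pA ->] | [/adP[l [srt sz ->]] /subP sub] |
        [/adP[l [srt sz ->]] /subP sub] | [[/adP[l [srt sz ->]]]]].
- exists [:: p]; split=> //; first by rewrite /mon_seq big_seq1.
  by constructor 1; split=> // q; rewrite inE => /eqP ->.
- by exists l; split=> //; constructor 2.
- rewrite card_indets_mon_seq ?nest_uniq // => cB.
  by exists l; split=> //; constructor 3.
rewrite !card_indets_mon_seq ?nest_uniq // => disj cB cBD cBC.
exists l; split=> //; constructor 4; split=> // p pl.
by rewrite (disjointFr disj) // indets_mon_seq inE.
Qed.

(** Equal sizes force equality. For a strictly smaller [l], type (i) is excluded since [A] is
    disjoint from the other regions; (ii) inside (iii) would put two members in [B], (ii) inside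
    (iv) two in the union of [B] and [C], and (iii) inside (iv) would put [t] in the union of [B]
    and [D]. *)
Lemma min_gens_antichain g g' : min_gens t a b g -> min_gens t a b g' ->
  (g <= g')%MM -> g = g'.
Proof.
case/min_gens_shape=> l [srt -> shl] /min_gens_shape[l' [srt' -> shl']] /mon_seq_sub sub.
have [ul ul'] := (nest_uniq srt, nest_uniq srt').
have le_sz := uniq_leq_size ul sub.
have cnt (E : {set indet n}) : (count (mem E) l <= count (mem E) l')%N.
  rewrite -!size_filter; apply: uniq_leq_size; first exact: filter_uniq.
  by move=> p; rewrite !mem_filter => /andP[-> /sub].
have cnt_all (E : {set indet n}) : {subset l <= E} -> (size l <= count (mem E) l')%N.
  move=> lE; apply: leq_trans (cnt E); rewrite -size_filter.
  by apply: uniq_leq_size => // p pl; rewrite mem_filter pl andbT /= lE.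
have [lesz | ltsz] := leqP (size l') (size l).
  have [_ eql] := uniq_min_size ul sub lesz.
  by apply: perm_big; apply: uniq_perm.
have inh : (0 < size l)%N -> exists2 p, p \in l & p \in l'.
  by case: (l) sub => // p l0 sub0 _; exists p; rewrite ?sub0 ?mem_head.
exfalso; case: shl => [[sz inA] | [sz inBC] | [sz inBD _] | [sz _ _ _]];
  case: shl' => [[sz' inA'] | [sz' inBC'] | [sz' inBD' cB'] | [sz' nA' cBD' cBC']];
  rewrite sz sz' in ltsz inh; try lia.
- have [//|p /inA pA /inBC'] := inh; by move: pA; rewrite !inE; lia.
- have [//|p /inA pA /inBD'] := inh; move: pA (valP p : (row_no p < col_no p)%N).
  by rewrite !inE; lia.
- by have [//|p /inA pA /nA'] := inh; rewrite pA.
- have lB : {subset l <= B}.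
    move=> p pl; have := inBC p pl; have := inBD' p (sub p pl).
    by rewrite !inE; lia.
  by have := cnt_all B lB; lia.
- by have := cnt_all _ inBC; lia.
by have := cnt_all _ inBD; lia.
Qed.

End Generators.

(** * The initial ideal of the cogenerated ideal *)

Lemma param_cogenerated (K : fieldType) n t (alpha : t.*2.-tuple 'I_n)
    (f : {mpoly K[#|{: indet n}|]}) :
  increasing alpha -> cogenerated alpha f -> param alpha f = 0.
Proof.
move=> inc [k [c [g [Sg ->]]]]; rewrite rmorph_sum big1 // => i _; rewrite rmorphM /=.
have [s [b [/andP[_ incb] nle ->]]] := Sg i.
by rewrite param_Pf_eq0 ?mulr0.
Qed.

Unset Implicit Arguments.
Local Close Scope ring_scope.

Theorem corollary3p4 (K : fieldType) (n t a b : nat)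
    (ht : (2 <= t)%N) (ha : (2 <= a)%N)
    (hab : (a + 2 * t - 3 < b)%N) (hbn : (b <= n)%N)
    (le : rel (mon n)) (hle : term_order le) (hdiag : anti_diagonal K le)
    (alpha : t.*2.-tuple 'I_n)
    (halpha : [seq (val i).+1 | i <- alpha] = (1 :: rcons (iota a (2 * t - 2)) b)%N) :
  generates (gens t a b) (initial_ideal le (cogenerated (K := K) alpha)) /\
  minimally_generates (min_gens t a b)
    (initial_ideal le (cogenerated (K := K) alpha)).
Proof.
have inc : increasing alpha by apply: alpha_increasing halpha hab.
have i0 : 'I_n by apply: (@Ordinal n 0); lia.
have gens_initial g : gens t a b g -> exists f : {mpoly K[#|{: indet n}|]},
    [/\ cogenerated alpha f, f \is (mdeg g).-homog & is_initial le f g].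
  move=> /(gens_Pf ht ha hab halpha)[s [c [PXc nle gE]]].
  have incc : increasing c by case/andP: PXc.
  exists (Pf K c); split; last by rewrite gE; apply: hdiag.
    rewrite -[Pf K c]mul1r; apply: ideal_genM; by exists s, c.
  have hom := Pf_dhomog K incc.
  have [gin _] := hdiag _ _ PXc.
  by rewrite gE (dhomog_mf hom gin).
have reducible m : ~~ standard alpha m -> exists h : {mpoly K[#|{: indet n}|]},
    [/\ param alpha h = 0%R, h \is (mdeg m).-homog & is_initial le h m].
  move=> /(nonstandard_has_gen ht ha halpha)[g /gens_initial[f [If homf inf]] le_gm].
  exists ('X_[(m - g)%MM] * f)%R; split.
  - by rewrite rmorphM /= (param_cogenerated inc If) mulr0.
  - rewrite -{2}(submK le_gm) mdegD; apply: dhomogM homf.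
    by rewrite dhomogX.
  rewrite -[m in is_initial _ _ m](submK le_gm); exact: is_initial_mulX.
have initial_has_gen f m : cogenerated (K := K) alpha f -> is_initial le f m ->
    has_gen t a b m.
  move=> /(param_cogenerated inc) f0 inf; apply: (nonstandard_has_gen ht ha halpha).
  exact: (initial_nonstandard i0 hle reducible f0 inf).
have gen_all : generates (gens t a b) (initial_ideal le (cogenerated (K := K) alpha)).
  move=> f; split; apply: sub_ideal_gen => q.
    move=> [h [m [Ih inh ->]]]; have [g gg le_gm] := initial_has_gen _ _ Ih inh.
    exists 'X_[(m - g)%MM]%R, 'X_[g]%R; split; first by exists g.
    by rewrite -mpolyXD submK.
  move=> [g /gens_initial[h [Ih _ inh]] ->]; exists 1%R, 'X_[g]%R.
  by split; [exists h, g | rewrite mul1r].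
split=> //; split.
  move=> f; rewrite gen_all; split; apply: sub_ideal_gen => q [g gg ->].
    have [g' gg' le_g] := gens_min_gens gg.
    exists 'X_[(g - g')%MM]%R, 'X_[g']%R; split; first by exists g'.
    by rewrite -mpolyXD submK.
  exists 1%R, 'X_[g]%R; split; last by rewrite mul1r.
  by exists g => //; apply: min_gens_gens.
move=> H sub genH g gg.
(* A generating subset must contain a divisor of [g], and within [min_gens] the only one is [g]. *)
have : ideal_gen (fun q : {mpoly K[#|{: indet n}|]} => exists2 u, H u & q = 'X_[u]%R) 'X_[g]%R.
  apply/genH/gen_all; rewrite -['X_[g]%R]mul1r; apply: ideal_genM.
  by exists g => //; apply: min_gens_gens.
case/mpolyX_ideal=> u Hu le_ug.
by rewrite -(min_gens_antichain ht ha hab (sub u Hu) gg le_ug).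
Qed.
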